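(* Let $\mathcal{A}$ be a small abelian category and let $\mathcal{C}\subseteq\mathcal{A}$ be a full additive, strictly full, Karoubi closed subcategory which is $\mathcal{A}$-approximating. For $M\in\mathcal{C}$ let $\mathsf{P}_M\in\mathcal{H}_{\mathcal{C}}$ be the complex with $M$ concentrated in degree $0$. Then $M\mapsto\mathsf{P}_M$ defines an equivalence of categories $\mathcal{C}\to\mathrm{Proj}(\mathcal{H}_{\mathcal{C}})$ onto the full subcategory of projective objects of $\mathcal{H}_{\mathcal{C}}$. The category $\mathcal{H}_{\mathcal{C}}$ has enough projectives. Hence the natural functor $\mathcal{T}_{\mathcal{C}}\cong K^-(\mathrm{Proj}(\mathcal{H}_{\mathcal{C}}))\to D^-(\mathcal{H}_{\mathcal{C}})$ is an equivalence of categories.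
   Context: Strictly full means closed under isomorphisms; Karoubi closed means closed under direct summands in $\mathcal{A}$. $\mathcal{T}_{\mathcal{C}}=K^-(\mathcal{C})$ (bounded above cochain complexes modulo homotopy) is a full triangulated subcategory of $\mathcal{T}_{\mathcal{A}}=K^-(\mathcal{A})$. A $\mathcal{C}$-approximation of $X\in\mathcal{T}_{\mathcal{A}}$ is a quasi-isomorphism $X_{\mathcal{C}}\to X$ with $X_{\mathcal{C}}\in\mathcal{T}_{\mathcal{C}}$ inducing an isomorphism $\mathrm{Hom}_{\mathcal{T}_{\mathcal{C}}}(-,X_{\mathcal{C}})\to\mathrm{Hom}_{\mathcal{T}_{\mathcal{A}}}(-,X)|_{\mathcal{T}_{\mathcal{C}}}$. $\mathcal{C}$ is $\mathcal{A}$-approximating if every $X\in\mathcal{T}_{\mathcal{A}}$ has a $\mathcal{C}$-approximation. $\mathcal{T}^{\leq 0}_{\mathcal{C}}$ is the strictly full subcategory of $\mathcal{T}_{\mathcal{C}}$ generated by complexes $X$ with $X^i=0$ for $i>0$; it is the $\leq 0$ part of a $t$-structure with $\mathcal{T}^{\geq 0}_{\mathcal{C}}=\{X\in\mathcal{T}_{\mathcal{C}}\mid\mathrm{Hom}(\mathcal{T}^{\leq 0}_{\mathcal{C}}[1],X)=0\}$; $\mathcal{H}_{\mathcal{C}}=\mathcal{T}^{\leq 0}_{\mathcal{C}}\cap\mathcal{T}^{\geq 0}_{\mathcal{C}}$ is its heart, an abelian category. *)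

(* Defs.v *)
From HB Require Import structures.
From mathcomp Require Import all_boot all_order all_algebra.
From mathcomp Require Import generic_quotient ring_quotient boolp.

Set Implicit Arguments.
Unset Strict Implicit.
Unset Printing Implicit Defensive.

Import Order.TTheory GRing.Theory Num.Theory.
Local Open Scope ring_scope.
Local Open Scope quotient_scope.

Record category := Category {
  obj :> Type;
  hom : obj -> obj -> Type;
  idm : forall X, hom X X;
  ccomp : forall X Y Z, hom Y Z -> hom X Y -> hom X Z;
  ccompA : forall W X Y Z (h : hom Y Z) (g : hom X Y) (f : hom W X),
    ccomp h (ccomp g f) = ccomp (ccomp h g) f;
  comp1m : forall X Y (f : hom X Y), ccomp (idm Y) f = f;
  compm1 : forall X Y (f : hom X Y), ccomp f (idm X) = f }.

Arguments hom {_} X Y.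
Arguments idm {_} X.
Arguments ccomp {_ X Y Z} g f.

Notation "g \co f" := (ccomp g f) (at level 40, left associativity).

Section CategoryNotions.
Variable C : category.
Implicit Types X Y Z : C.

Definition is_iso X Y (f : hom X Y) : Prop :=
  exists g : hom Y X, g \co f = idm X /\ f \co g = idm Y.

Definition isomorphic X Y : Prop := exists f : hom X Y, is_iso f.

Definition is_mono X Y (f : hom X Y) : Prop :=
  forall Z (u v : hom Z X), f \co u = f \co v -> u = v.

Definition is_epi X Y (f : hom X Y) : Prop :=
  forall Z (u v : hom Y Z), u \co f = v \co f -> u = v.

Definition is_projective (P : C) : Prop :=
  forall X Y (e : hom X Y) (f : hom P Y), is_epi e ->
    exists g : hom P X, e \co g = f.

Definition enough_projectives : Prop :=
  forall X, exists (P : C) (e : hom P X), is_projective P /\ is_epi e.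

End CategoryNotions.

Record functor (C D : category) := Functor {
  fobj :> C -> D;
  fmap : forall X Y : C, hom X Y -> hom (fobj X) (fobj Y);
  fmap1 : forall X : C, fmap (idm X) = idm (fobj X);
  fmapM : forall (X Y Z : C) (g : hom Y Z) (f : hom X Y),
    fmap (g \co f) = fmap g \co fmap f }.

Arguments fmap {C D} F {X Y} f : rename.

Definition functor_id (C : category) : functor C C :=
  @Functor C C id (fun X Y f => f) (fun _ => erefl) (fun _ _ _ _ _ => erefl).

Section FunctorComp.
Variables (C D E : category) (G : functor D E) (F : functor C D).

Lemma functor_comp1 (X : C) : fmap G (fmap F (idm X)) = idm (G (F X)).
Proof. by rewrite !fmap1. Qed.

Lemma functor_compM (X Y Z : C) (g : hom Y Z) (f : hom X Y) :
  fmap G (fmap F (g \co f)) = fmap G (fmap F g) \co fmap G (fmap F f).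
Proof. by rewrite !fmapM. Qed.

Definition functor_comp : functor C E :=
  @Functor C E (fun X => G (F X)) (fun X Y f => fmap G (fmap F f))
    functor_comp1 functor_compM.

End FunctorComp.

Definition nat_isomorphic (C D : category) (F G : functor C D) : Prop :=
  exists a : forall X : C, hom (F X) (G X),
    (forall X, is_iso (a X)) /\
    (forall (X Y : C) (f : hom X Y), a Y \co fmap F f = fmap G f \co a X).

Definition is_equivalence (C D : category) (F : functor C D) : Prop :=
  exists G : functor D C,
    nat_isomorphic (functor_comp G F) (functor_id C) /\
    nat_isomorphic (functor_comp F G) (functor_id D).

Record preadditive := Preadditive {
  pcat :> category;
  pzmod : forall X Y : pcat, GRing.Zmodule (hom X Y);
  (* the group laws are written with the structure packed from [pzmod] *)
  compDr : forall (X Y Z : pcat) (g : hom Y Z)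
      (f f' : GRing.Zmodule.Pack (pzmod X Y)),
    g \co (f + f') =
      ((g \co f : GRing.Zmodule.Pack (pzmod X Z)) + (g \co f'))%R;
  compDl : forall (X Y Z : pcat) (g g' : GRing.Zmodule.Pack (pzmod Y Z))
      (f : hom X Y),
    (g + g') \co f =
      ((g \co f : GRing.Zmodule.Pack (pzmod X Z)) + (g' \co f))%R }.

HB.instance Definition _ (A : preadditive) (X Y : A) :
  GRing.Zmodule (@hom (pcat A) X Y) := pzmod X Y.

Section PreadditiveTheory.
Variable A : preadditive.
Implicit Types X Y Z : A.

Lemma comp_addr X Y Z (g : hom Y Z) (f f' : hom X Y) :
  g \co (f + f') = g \co f + g \co f'.
Proof. exact: compDr. Qed.

Lemma comp_addl X Y Z (g g' : hom Y Z) (f : hom X Y) :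
  (g + g') \co f = g \co f + g' \co f.
Proof. exact: compDl. Qed.

Lemma comp0m X Y Z (f : hom X Y) : (0 : hom Y Z) \co f = 0.
Proof. by apply: (addrI (0 \co f)); rewrite -comp_addl !addr0. Qed.

Lemma compm0 X Y Z (g : hom Y Z) : g \co (0 : hom X Y) = 0.
Proof. by apply: (addrI (g \co 0)); rewrite -comp_addr !addr0. Qed.

Lemma comp_oppl X Y Z (g : hom Y Z) (f : hom X Y) : (- g) \co f = - (g \co f).
Proof. by apply: (addrI (g \co f)); rewrite -comp_addl !subrr comp0m. Qed.

Lemma comp_oppr X Y Z (g : hom Y Z) (f : hom X Y) : g \co (- f) = - (g \co f).
Proof. by apply: (addrI (g \co f)); rewrite -comp_addr !subrr compm0. Qed.

Definition is_zero Z : Prop :=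
  (forall X (f : hom X Z), f = 0) /\ (forall X (f : hom Z X), f = 0).

Definition is_biproduct X1 X2 S : Prop :=
  exists (i1 : hom X1 S) (i2 : hom X2 S) (p1 : hom S X1) (p2 : hom S X2),
    [/\ p1 \co i1 = idm X1, p2 \co i2 = idm X2, p1 \co i2 = 0, p2 \co i1 = 0
      & i1 \co p1 + i2 \co p2 = idm S].

Definition is_kernel X Y K (f : hom X Y) (k : hom K X) : Prop :=
  f \co k = 0 /\
  forall W (g : hom W X), f \co g = 0 -> exists! h : hom W K, k \co h = g.

Definition is_cokernel X Y Q (f : hom X Y) (q : hom Y Q) : Prop :=
  q \co f = 0 /\
  forall W (g : hom Y W), g \co f = 0 -> exists! h : hom Q W, h \co q = g.

End PreadditiveTheory.

Record is_additive (A : preadditive) : Prop := IsAdditive {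
  has_zero : exists Z : A, is_zero Z;
  has_biproducts : forall X Y : A, exists S, is_biproduct X Y S }.

Record is_abelian (A : preadditive) : Prop := IsAbelian {
  abelian_additive : is_additive A;
  has_kernels : forall (X Y : A) (f : hom X Y),
    exists (K : A) (k : hom K X), is_kernel f k;
  has_cokernels : forall (X Y : A) (f : hom X Y),
    exists (Q : A) (q : hom Y Q), is_cokernel f q;
  mono_normal : forall (X Y : A) (m : hom X Y), is_mono m ->
    exists (Z : A) (g : hom Y Z), is_kernel g m;
  epi_normal : forall (X Y : A) (e : hom X Y), is_epi e ->
    exists (Z : A) (g : hom Z X), is_cokernel g e }.

Record add_functor (A B : preadditive) := AddFunctor {
  afunctor :> functor A B;
  fmapD : forall (X Y : A) (f g : hom X Y),
    fmap afunctor (f + g) = fmap afunctor f + fmap afunctor g }.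

Section AddFunctorTheory.
Variables (A B : preadditive) (F : add_functor A B).

Lemma fmap0 (X Y : A) : fmap F (0 : hom X Y) = 0.
Proof. by apply: (addrI (fmap F 0)); rewrite -fmapD !addr0. Qed.

Lemma fmapN (X Y : A) (f : hom X Y) : fmap F (- f) = - fmap F f.
Proof. by apply: (addrI (fmap F f)); rewrite -fmapD !subrr fmap0. Qed.

Lemma fmap_is_zero (Z : A) : is_zero Z -> is_zero (F Z).
Proof.
case=> _ Z0; have id0 : idm (F Z) = 0 by rewrite -fmap1 (Z0 _ (idm Z)) fmap0.
split=> X f; first by rewrite -(comp1m f) id0 comp0m.
by rewrite -(compm1 f) id0 compm0.
Qed.

End AddFunctorTheory.

Section FullSub.
Variables (A : preadditive) (P : A -> Prop).

Definition fullsub_cat : category :=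
  @Category {X : A | P X} (fun X Y => hom (sval X) (sval Y))
    (fun X => idm (sval X)) (fun X Y Z g f => g \co f)
    (fun _ _ _ _ => @ccompA A _ _ _ _) (fun _ _ => @comp1m A _ _)
    (fun _ _ => @compm1 A _ _).

Definition fullsub : preadditive :=
  @Preadditive fullsub_cat (fun X Y => pzmod (sval X) (sval Y))
    (fun X Y Z => @compDr A (sval X) (sval Y) (sval Z))
    (fun X Y Z => @compDl A (sval X) (sval Y) (sval Z)).

Definition fullsub_incl : add_functor fullsub A :=
  @AddFunctor fullsub A
    (@Functor fullsub A sval (fun X Y f => f) (fun _ => erefl)
       (fun _ _ _ _ _ => erefl))
    (fun _ _ _ _ => erefl).

Definition fullsub_lift (B : preadditive) (F : add_functor B A)
    (FP : forall X, P (F X)) : add_functor B fullsub :=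
  @AddFunctor B fullsub
    (@Functor B fullsub (fun X => exist P (F X) (FP X)) (fun X Y f => fmap F f)
       (fmap1 F) (fmapM F))
    (@fmapD _ _ F).

Definition strictly_full : Prop :=
  forall X Y : A, isomorphic X Y -> P X -> P Y.

Definition karoubi_closed : Prop :=
  forall X X' Y : A, is_biproduct X X' Y -> P Y -> P X.

End FullSub.

Arguments fullsub_incl {A} P.
Arguments fullsub_lift {A} P {B} F FP.

Definition Proj (H : preadditive) : preadditive := fullsub (@is_projective H).

Definition Proj_incl (H : preadditive) : add_functor (Proj H) H :=
  fullsub_incl (@is_projective H).

Record complex (B : preadditive) := Complex {
  cx :> int -> B;
  cxd : forall n, hom (cx n) (cx (n + 1));
  cxdd : forall n, cxd (n + 1) \co cxd n = 0;
  cx_bounded : exists N : int, forall n : int, N < n -> is_zero (cx n) }.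

Arguments cxd {B} X n : rename.

Record chain_map (B : preadditive) (X Y : complex B) := ChainMap {
  cmap :> forall n, hom (X n) (Y n);
  cmap_comm : forall n, cxd Y n \co cmap n = cmap (n + 1) \co cxd X n }.

Section ChainMaps.
Variable B : preadditive.

Lemma chain_map_eq (X Y : complex B) (f g : chain_map X Y) :
  (forall n, f n = g n) -> f = g.
Proof.
case: f g => [f fP] [g gP] /= fg; have {}fg : f = g by exact: functional_extensionality_dep.
by case: _ / fg in gP *; congr ChainMap; apply: Prop_irrelevance.
Qed.

Section Group.
Variables X Y : complex B.
Implicit Types f g : chain_map X Y.

HB.instance Definition _ := gen_eqMixin (chain_map X Y).
HB.instance Definition _ := gen_choiceMixin (chain_map X Y).

Definition chain_zero : chain_map X Y.
Proof. by exists (fun n => 0) => n; rewrite comp0m compm0. Defined.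

Definition chain_opp f : chain_map X Y.
Proof. by exists (fun n => - f n) => n; rewrite comp_oppl comp_oppr cmap_comm. Defined.

Definition chain_add f g : chain_map X Y.
Proof.
by exists (fun n => f n + g n) => n; rewrite comp_addl comp_addr !cmap_comm.
Defined.

Lemma chain_addA : associative chain_add.
Proof. by move=> f g h; apply: chain_map_eq => n /=; rewrite addrA. Qed.

Lemma chain_addC : commutative chain_add.
Proof. by move=> f g; apply: chain_map_eq => n /=; rewrite addrC. Qed.

Lemma chain_add0 : left_id chain_zero chain_add.
Proof. by move=> f; apply: chain_map_eq => n /=; rewrite add0r. Qed.

Lemma chain_addN : left_inverse chain_zero chain_opp chain_add.
Proof. by move=> f; apply: chain_map_eq => n /=; rewrite addNr. Qed.

HB.instance Definition _ := GRing.isZmodule.Build (chain_map X Y)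
  chain_addA chain_addC chain_add0 chain_addN.

(* [n + 1] ranges over all integers; indexing by it avoids a transport along
   [n - 1 + 1 = n]. *)
Definition null_homotopic f : Prop :=
  exists h : forall n : int, hom (X (n + 1)) (Y n),
    forall n, f (n + 1) = cxd Y n \co h n + h (n + 1) \co cxd X (n + 1).

Definition null_pred : {pred chain_map X Y} := fun f => `[< null_homotopic f >].

Lemma null_zmod_closed : zmod_closed null_pred.
Proof.
split=> [|f g /asboolP[h hf] /asboolP[k kg]]; apply/asboolP.
  by exists (fun n => 0) => n; rewrite compm0 comp0m addr0.
exists (fun n => h n - k n) => n /=.
rewrite hf kg comp_addr comp_addl comp_oppr comp_oppl opprD.
exact: addrACA.
Qed.

HB.instance Definition _ :=
  GRing.isZmodClosed.Build (chain_map X Y) null_pred null_zmod_closed.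

Definition khom : zmodType := Quotient.quot null_pred.

Definition kclass f : khom := \pi f.

Lemma kclassP f g : kclass f = kclass g <-> null_homotopic (f - g).
Proof.
split=> [/eqP|nfg].
  by rewrite /kclass -Quotient.idealrBE => /asboolP.
by apply/eqP; rewrite /kclass -Quotient.idealrBE; apply/asboolP.
Qed.

Lemma kclassD f g : kclass (f + g) = kclass f + kclass g.
Proof. by rewrite /kclass !piE. Qed.

Lemma kclass_repr (u : khom) : kclass (repr u) = u.
Proof. exact: reprK. Qed.

End Group.

Definition chain_id (X : complex B) : chain_map X X.
Proof. by exists (fun n => idm (X n)) => n; rewrite compm1 comp1m. Defined.

Definition chain_comp (X Y Z : complex B) (g : chain_map Y Z)
  (f : chain_map X Y) : chain_map X Z.
Proof.
exists (fun n => g n \co f n) => n.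
by rewrite ccompA cmap_comm -ccompA cmap_comm ccompA.
Defined.

Lemma null_compl (X Y Z : complex B) (g : chain_map Y Z) (f : chain_map X Y) :
  null_homotopic f -> null_homotopic (chain_comp g f).
Proof.
case=> h hf; exists (fun n => g n \co h n) => n /=.
by rewrite hf comp_addr !ccompA cmap_comm.
Qed.

Lemma null_compr (X Y Z : complex B) (g : chain_map Y Z) (f : chain_map X Y) :
  null_homotopic g -> null_homotopic (chain_comp g f).
Proof.
case=> h hg; exists (fun n => h n \co f (n + 1)) => n /=.
by rewrite hg comp_addl -!ccompA cmap_comm.
Qed.

Definition kcomp (X Y Z : complex B) (v : khom Y Z) (u : khom X Y) : khom X Z :=
  kclass (chain_comp (repr v) (repr u)).

Lemma kcompE (X Y Z : complex B) (g : chain_map Y Z) (f : chain_map X Y) :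
  kcomp (kclass g) (kclass f) = kclass (chain_comp g f).
Proof.
rewrite /kcomp; set g' := repr _; set f' := repr _.
have /kclassP ng : kclass g' = kclass g by exact: kclass_repr.
have /kclassP nf : kclass f' = kclass f by exact: kclass_repr.
apply/kclassP.
have /asboolP n1 := null_compl g' nf; have /asboolP n2 := null_compr f ng.
have -> : chain_comp g' f' - chain_comp g f
    = chain_comp g' (f' - f) + chain_comp (g' - g) f.
  apply: chain_map_eq => n /=.
  by rewrite comp_addr comp_addl comp_oppr comp_oppl addrA addrNK.
by apply/asboolP; apply: (@rpredD _ (null_pred (X:=X) (Y:=Z))).
Qed.

Lemma kcompA (W X Y Z : complex B) (h : khom Y Z) (g : khom X Y) (f : khom W X) :
  kcomp h (kcomp g f) = kcomp (kcomp h g) f.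
Proof.
rewrite -(kclass_repr h) -(kclass_repr g) -(kclass_repr f) !kcompE.
by congr kclass; apply: chain_map_eq => n /=; rewrite ccompA.
Qed.

Lemma kcomp1m (X Y : complex B) (f : khom X Y) :
  kcomp (kclass (chain_id Y)) f = f.
Proof.
rewrite -(kclass_repr f) kcompE.
by congr kclass; apply: chain_map_eq => n /=; rewrite comp1m.
Qed.

Lemma kcompm1 (X Y : complex B) (f : khom X Y) :
  kcomp f (kclass (chain_id X)) = f.
Proof.
rewrite -(kclass_repr f) kcompE.
by congr kclass; apply: chain_map_eq => n /=; rewrite compm1.
Qed.

Lemma kcompDr (X Y Z : complex B) (g : khom Y Z) (f f' : khom X Y) :
  kcomp g (f + f') = kcomp g f + kcomp g f'.
Proof.
rewrite -(kclass_repr g) -(kclass_repr f) -(kclass_repr f') -kclassD !kcompE.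
by rewrite -kclassD; congr kclass; apply: chain_map_eq => n /=; rewrite comp_addr.
Qed.

Lemma kcompDl (X Y Z : complex B) (g g' : khom Y Z) (f : khom X Y) :
  kcomp (g + g') f = kcomp g f + kcomp g' f.
Proof.
rewrite -(kclass_repr g) -(kclass_repr g') -(kclass_repr f) -kclassD !kcompE.
by rewrite -kclassD; congr kclass; apply: chain_map_eq => n /=; rewrite comp_addl.
Qed.

End ChainMaps.

Definition Kminus_cat (B : preadditive) : category :=
  @Category (complex B) (fun X Y => khom X Y) (fun X => kclass (chain_id X))
    (@kcomp B) (@kcompA B) (@kcomp1m B) (@kcompm1 B).

Definition Kminus (B : preadditive) : preadditive :=
  @Preadditive (Kminus_cat B) (fun X Y => GRing.Zmodule.class (khom X Y))
    (@kcompDr B) (@kcompDl B).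

Section KminusFunctor.
Variables (A B : preadditive) (F : add_functor A B).

Definition map_complex (X : complex A) : complex B.
Proof.
exists (fun n => F (X n)) (fun n => fmap F (cxd X n)) => [n|].
  by rewrite -fmapM cxdd fmap0.
by case: (cx_bounded X) => N XN; exists N => n /XN; apply: fmap_is_zero.
Defined.

Definition map_chain (X Y : complex A) (f : chain_map X Y) :
  chain_map (map_complex X) (map_complex Y).
Proof. by exists (fun n => fmap F (f n)) => n /=; rewrite -!fmapM cmap_comm. Defined.

Definition map_khom (X Y : complex A) (u : khom X Y) :
  khom (map_complex X) (map_complex Y) := kclass (map_chain (repr u)).

Lemma map_khomE (X Y : complex A) (f : chain_map X Y) :
  map_khom (kclass f) = kclass (map_chain f).
Proof.
apply/kclassP; set f' := repr _.
have /kclassP[h hf] : kclass f' = kclass f by exact: kclass_repr.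
exists (fun n => fmap F (h n)) => n /=.
by rewrite -!fmapM -fmapD -hf /= fmapD fmapN.
Qed.

Lemma map_khom1 (X : complex A) :
  map_khom (kclass (chain_id X)) = kclass (chain_id (map_complex X)).
Proof.
by rewrite map_khomE; congr kclass; apply: chain_map_eq => n /=; rewrite fmap1.
Qed.

Lemma map_khomM (X Y Z : complex A) (g : khom Y Z) (f : khom X Y) :
  map_khom (kcomp g f) = kcomp (map_khom g) (map_khom f).
Proof.
rewrite -(kclass_repr g) -(kclass_repr f) kcompE !map_khomE kcompE.
by congr kclass; apply: chain_map_eq => n /=; rewrite fmapM.
Qed.

Lemma map_khomD (X Y : complex A) (f g : khom X Y) :
  map_khom (f + g) = map_khom f + map_khom g.
Proof.
rewrite -(kclass_repr g) -(kclass_repr f) -kclassD !map_khomE -kclassD.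
by congr kclass; apply: chain_map_eq => n /=; rewrite fmapD.
Qed.

Definition Kminus_map : add_functor (Kminus A) (Kminus B) :=
  @AddFunctor (Kminus A) (Kminus B)
    (@Functor (Kminus A) (Kminus B) map_complex map_khom map_khom1 map_khomM)
    map_khomD.

End KminusFunctor.

(* A computation of [H^(n+1)(X)] as the cokernel of the corestriction of
   [cxd X n] to a kernel of [cxd X (n + 1)].  If [B] is abelian such data exist
   and are unique up to a unique isomorphism, so that [chain_qis] below does not
   depend on them. *)
Record cohomology (B : preadditive) (X : complex B) (n : int) := Cohomology {
  cyc : B;
  cyc_in : hom cyc (X (n + 1));
  cyc_kernel : is_kernel (cxd X (n + 1)) cyc_in;
  bnd : hom (X n) cyc;
  bndE : cyc_in \co bnd = cxd X n;
  coh : B;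
  coh_pr : hom cyc coh;
  coh_cokernel : is_cokernel bnd coh_pr }.

(* [h] is the map H^(n+1)(f). *)
Definition chain_qis (B : preadditive) (X Y : complex B) (f : chain_map X Y) :
    Prop :=
  forall n (HX : cohomology X n) (HY : cohomology Y n)
    (z : hom (cyc HX) (cyc HY)) (h : hom (coh HX) (coh HY)),
  cyc_in HY \co z = f (n + 1) \co cyc_in HX ->
  h \co coh_pr HX = coh_pr HY \co z ->
  is_iso h.

Definition quasi_iso (B : preadditive) (X Y : Kminus B) (u : hom X Y) : Prop :=
  exists2 f : chain_map X Y, kclass f = u & chain_qis f.

(* The category obtained from [C] by formally inverting the morphisms in [W]:
   formal composites of morphisms of [C] and inverses of morphisms in [W],
   modulo the congruence generated by the evident relations. *)
Section Localization.
Variables (C : category) (W : forall X Y : C, hom X Y -> Prop).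

Inductive fterm : C -> C -> Type :=
| fmor X Y : hom X Y -> fterm X Y
| finv X Y (s : hom X Y) : W s -> fterm Y X
| fcomp X Y Z : fterm Y Z -> fterm X Y -> fterm X Z.

Inductive feq : forall X Y, fterm X Y -> fterm X Y -> Prop :=
| feq_refl X Y (t : fterm X Y) : feq t t
| feq_sym X Y (t u : fterm X Y) : feq t u -> feq u t
| feq_trans X Y (t u v : fterm X Y) : feq t u -> feq u v -> feq t v
| feq_comp X Y Z (t t' : fterm Y Z) (u u' : fterm X Y) :
    feq t t' -> feq u u' -> feq (fcomp t u) (fcomp t' u')
| feq_compA X1 X2 X3 X4 (t : fterm X3 X4) (u : fterm X2 X3) (v : fterm X1 X2) :
    feq (fcomp t (fcomp u v)) (fcomp (fcomp t u) v)
| feq_1l X Y (t : fterm X Y) : feq (fcomp (fmor (idm Y)) t) t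
| feq_1r X Y (t : fterm X Y) : feq (fcomp t (fmor (idm X))) t
| feq_mor X Y Z (g : hom Y Z) (f : hom X Y) :
    feq (fmor (g \co f)) (fcomp (fmor g) (fmor f))
| feq_invl X Y (s : hom X Y) (sW : W s) :
    feq (fcomp (finv sW) (fmor s)) (fmor (idm X))
| feq_invr X Y (s : hom X Y) (sW : W s) :
    feq (fcomp (fmor s) (finv sW)) (fmor (idm Y)).

Definition feqb (X Y : C) (t u : {classic fterm X Y}) : bool := `[< feq t u >].

Lemma feqb_equiv (X Y : C) : equiv_class_of (@feqb X Y).
Proof.
split=> [t|t u|u t v].
- by apply/asboolP/feq_refl.
- by apply/asboolP/asboolP => /feq_sym.
- by move=> /asboolP tu /asboolP uv; apply/asboolP/(feq_trans tu).
Qed.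

Canonical feqb_equiv_rel (X Y : C) := EquivRelPack (feqb_equiv X Y).

Definition lochom (X Y : C) : Type := {eq_quot (@feqb X Y)}.

Definition locclass (X Y : C) (t : fterm X Y) : lochom X Y :=
  \pi_({eq_quot (@feqb X Y)}) (t : {classic fterm X Y}).

Definition locrepr (X Y : C) (u : lochom X Y) : fterm X Y :=
  repr (u : {eq_quot (@feqb X Y)}).

Lemma locrepr_class (X Y : C) (u : lochom X Y) : locclass (locrepr u) = u.
Proof. exact: reprK. Qed.

Lemma locclassP (X Y : C) (t u : fterm X Y) : locclass t = locclass u <-> feq t u.
Proof.
split=> [/eqP|tu]; first by rewrite /locclass eqmodE => /asboolP.
by apply/eqP; rewrite /locclass eqmodE; apply/asboolP.
Qed.

Definition loccomp (X Y Z : C) (v : lochom Y Z) (u : lochom X Y) : lochom X Z :=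
  locclass (fcomp (locrepr v) (locrepr u)).

Lemma loccompE (X Y Z : C) (t : fterm Y Z) (u : fterm X Y) :
  loccomp (locclass t) (locclass u) = locclass (fcomp t u).
Proof.
by apply/locclassP; apply: feq_comp; apply/locclassP; rewrite locrepr_class.
Qed.

Lemma loccompA (X1 X2 X3 X4 : C)
    (t : lochom X3 X4) (u : lochom X2 X3) (v : lochom X1 X2) :
  loccomp t (loccomp u v) = loccomp (loccomp t u) v.
Proof.
rewrite -(locrepr_class t) -(locrepr_class u) -(locrepr_class v) !loccompE.
by apply/locclassP/feq_compA.
Qed.

Lemma loccomp1m (X Y : C) (t : lochom X Y) :
  loccomp (locclass (fmor (idm Y))) t = t.
Proof. by rewrite -(locrepr_class t) loccompE; apply/locclassP/feq_1l. Qed.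

Lemma loccompm1 (X Y : C) (t : lochom X Y) :
  loccomp t (locclass (fmor (idm X))) = t.
Proof. by rewrite -(locrepr_class t) loccompE; apply/locclassP/feq_1r. Qed.

Definition localization : category :=
  @Category C lochom (fun X => locclass (fmor (idm X)))
    loccomp loccompA loccomp1m loccompm1.

Lemma loc_functorM (X Y Z : C) (g : hom Y Z) (f : hom X Y) :
  locclass (fmor (g \co f)) = loccomp (locclass (fmor g)) (locclass (fmor f)).
Proof. by rewrite loccompE; apply/locclassP/feq_mor. Qed.

Definition loc_functor : functor C localization :=
  @Functor C localization id (fun X Y f => locclass (fmor f))
    (fun _ => erefl) loc_functorM.

End Localization.

(* For abelian [B]; the objects are the bounded above complexes. *)
Definition Dminus (B : preadditive) : category :=
  localization (@quasi_iso B).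

Definition Dminus_functor (B : preadditive) : functor (Kminus B) (Dminus B) :=
  loc_functor (@quasi_iso B).

Definition is_approximation (A : preadditive) (C : A -> Prop) (X : Kminus A)
    (XC : Kminus (fullsub C))
    (f : hom (Kminus_map (fullsub_incl C) XC) X) : Prop :=
  quasi_iso f /\
  forall Y : Kminus (fullsub C),
    bijective (fun g : hom Y XC => f \co fmap (Kminus_map (fullsub_incl C)) g).

Definition approximating (A : preadditive) (C : A -> Prop) : Prop :=
  forall X : Kminus A, exists (XC : Kminus (fullsub C))
    (f : hom (Kminus_map (fullsub_incl C) XC) X), is_approximation f.

Section Heart.
Variable B : preadditive.

Definition shift (X : Kminus B) : Kminus B.
Proof.
exists (fun n => X (n + 1)) (fun n => - cxd X (n + 1)) => [n|].
  by rewrite comp_oppl comp_oppr opprK cxdd.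
case: (cx_bounded X) => N XN; exists N => n Nn.
by apply: XN; rewrite (lt_trans Nn) // ltrDl.
Defined.

Definition T_le0 (X : Kminus B) : Prop :=
  exists Y : Kminus B,
    (forall n : int, 0 < n -> is_zero ((Y : complex B) n)) /\ isomorphic X Y.

Definition T_ge0 (X : Kminus B) : Prop :=
  forall (Y : Kminus B) (f : hom (shift Y) X), T_le0 Y -> f = 0.

Definition in_heart (X : Kminus B) : Prop := T_le0 X /\ T_ge0 X.

Definition heart : preadditive := fullsub in_heart.

End Heart.

Section Stalk.
Variables (B : preadditive) (addB : is_additive B).

Definition zero_obj : B := sval (cid (has_zero addB)).

Lemma zero_objP : is_zero zero_obj.
Proof. exact: svalP (cid (has_zero addB)). Qed.

Definition stalk_ob (M : B) (n : int) : B :=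
  match n with Posz 0 => M | _ => zero_obj end.

Definition stalk (M : B) : complex B.
Proof.
exists (stalk_ob M) (fun n => 0) => [n|]; first by rewrite comp0m.
by exists 0; case=> [[|n]|n] // _; apply: zero_objP.
Defined.

Definition stalk_mor (M N : B) (f : hom M N) (n : int) :
    hom (stalk_ob M n) (stalk_ob N n) :=
  match n with Posz 0 => f | _ => 0 end.

Definition stalk_chain (M N : B) (f : hom M N) : chain_map (stalk M) (stalk N).
Proof. by exists (stalk_mor f) => n; rewrite comp0m compm0. Defined.

Lemma stalk1 (M : B) :
  kclass (stalk_chain (idm M)) = kclass (chain_id (stalk M)).
Proof.
by congr kclass; apply: chain_map_eq; case=> [[|n]|n] //=; rewrite (zero_objP.1 _ (idm _)).
Qed.

Lemma stalkM (M N P : B) (g : hom N P) (f : hom M N) :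
  kclass (stalk_chain (g \co f)) =
  kcomp (kclass (stalk_chain g)) (kclass (stalk_chain f)).
Proof.
rewrite kcompE; congr kclass.
by apply: chain_map_eq; case=> [[|n]|n] //=; rewrite comp0m.
Qed.

Lemma stalkD (M N : B) (f g : hom M N) :
  kclass (stalk_chain (f + g)) = kclass (stalk_chain f) + kclass (stalk_chain g).
Proof.
rewrite -kclassD; congr kclass.
by apply: chain_map_eq; case=> [[|n]|n] //=; rewrite addr0.
Qed.

Definition stalk_functor : add_functor B (Kminus B) :=
  @AddFunctor B (Kminus B)
    (@Functor B (Kminus B) stalk (fun M N f => kclass (stalk_chain f))
       stalk1 stalkM)
    stalkD.

Section Corestriction.
Hypothesis PH : forall M, in_heart (stalk_functor M).

Definition P_heart : add_functor B (heart B) :=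
  fullsub_lift (@in_heart B) stalk_functor PH.

Hypothesis PP : forall M, is_projective (P_heart M).

Definition P_proj : add_functor B (Proj (heart B)) :=
  fullsub_lift (@is_projective (heart B)) P_heart PP.

End Corestriction.

End Stalk.

(* Main.v *)
(* If X_C is a C-approximation of an object X of A, seen as a complex in degree 0, then
   lifting the maps from stalk complexes shows that every map from C to X factors through
   the term of degree 0 of X_C.  Applied to kernels this gives weak kernels in C.  Hence
   the heart consists of the complexes in degrees <= 0 on which Hom(M, -) is exact in
   negative degrees, for M in C, and such a complex is the cokernel of P(X^-1) -> P(X^0):
   the heart is the category of finitely presented functors on C.  Its kernels and
   cokernels are computed from weak kernels in C, the objects P_M are projective, and a
   projective object is a direct summand of some P_M, hence itself of this form.
   For the derived category, Hom(P, -) inverts quasi-isomorphisms when P is a bounded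
   above complex of projectives, and every bounded above complex X has a quasi-isomorphism
   P -> X, built by descending induction on the degree. *)

From HB Require Import structures.
From mathcomp Require Import all_boot all_order all_algebra.
From mathcomp Require Import boolp.
Require Import Defs.

Set Implicit Arguments.
Unset Strict Implicit.
Unset Printing Implicit Defensive.

Import Order.TTheory GRing.Theory Num.Theory.
Local Open Scope ring_scope.

(** * Equivalences and integer-indexed families *)

Lemma dependent_choice (T : Type) (U : T -> Type) (P : forall x, U x -> Prop) :
  (forall x, exists y : U x, P x y) -> exists f : forall x, U x, forall x, P x (f x).
Proof.
move=> /(_ _)/cid pick; exists (fun x => projT1 (pick x)) => x.
exact: projT2 (pick x).
Qed.

Section Equivalences.
Variables (C D : category) (F : functor C D).

Definition full : Prop :=
  forall (X Y : C) (g : hom (F X) (F Y)), exists f : hom X Y, fmap F f = g.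

Definition faithful : Prop :=
  forall (X Y : C) (f g : hom X Y), fmap F f = fmap F g -> f = g.

Definition ess_surjective : Prop :=
  forall Y : D, exists X : C, isomorphic (F X) Y.

Lemma equivalence_of_full_faithful :
  full -> faithful -> ess_surjective -> is_equivalence F.
Proof.
move=> Ffull Ffaith Fes.
have /dependent_choice[G0 /dependent_choice[e /dependent_choice[e' ee']]] := Fes.
have e'e Y : e' Y \co e Y = idm _ := (ee' Y).1.
have {}ee' Y : e Y \co e' Y = idm _ := (ee' Y).2.
have G1ex X Y (f : hom X Y) : exists g, fmap F g = e' Y \co f \co e X by exact: Ffull.
pose G1 X Y (f : hom X Y) := projT1 (cid (G1ex X Y f)).
have G1E X Y (f : hom X Y) : fmap F (G1 X Y f) = e' Y \co f \co e X.
  exact: projT2 (cid (G1ex X Y f)).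
have G11 X : G1 X X (idm X) = idm (G0 X).
  by apply: Ffaith; rewrite G1E fmap1 compm1 e'e.
have G1M X Y Z (g : hom Y Z) (f : hom X Y) :
    G1 X Z (g \co f) = G1 Y Z g \co G1 X Y f.
  apply: Ffaith; rewrite fmapM !G1E -!ccompA; congr (_ \co (_ \co _)).
  by rewrite !ccompA ee' comp1m.
exists (Functor G11 G1M); split.
  have inv X : exists v : hom (G0 (F X)) X, fmap F v = e (F X) by exact: Ffull.
  have inv' X : exists v : hom X (G0 (F X)), fmap F v = e' (F X) by exact: Ffull.
  exists (fun X => projT1 (cid (inv X))); split=> [X|X Y f] /=.
    case: (cid _) => v /= vE; have [w wE] := inv' X.
    by exists w; split; apply: Ffaith; rewrite fmapM vE wE fmap1 ?e'e ?ee'.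
  case: (cid _) => v /= vE; case: (cid _) => w /= wE.
  by apply: Ffaith; rewrite !fmapM vE wE G1E !ccompA ee' comp1m.
exists e; split=> [Y|X Y f] /=; first by exists (e' Y).
by rewrite G1E !ccompA ee' comp1m.
Qed.

End Equivalences.

Lemma isomorphic_refl (C : category) (X : C) : isomorphic X X.
Proof. by exists (idm X), (idm X); rewrite comp1m. Qed.

Lemma isomorphic_sym (C : category) (X Y : C) : isomorphic X Y -> isomorphic Y X.
Proof. by case=> f [g [gf fg]]; exists g, f. Qed.

(** Chain maps and homotopies are built below with components indexed by [n + 1]; this confines the
    transport along [n - 1 + 1 = n] to one place. *)
Lemma shift_family (T : int -> Type) (f : forall n : int, T (n + 1)) :
  exists g : forall n : int, T n, forall n : int, g (n + 1) = f n.
Proof.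
have e (n : int) : n - 1 + 1 = n by rewrite subrK.
exists (fun n => eq_rect _ T (f (n - 1)) _ (e n)) => n.
have gen (m : int) (e' : m + 1 = n + 1) : eq_rect _ T (f m) _ e' = f n.
  have mn := addIr 1 e'; case: _ / mn in e' *.
  by rewrite (Prop_irrelevance e' erefl).
exact: gen.
Qed.

Lemma forall_shift (Q : int -> Prop) : (forall n : int, Q (n + 1)) -> forall n : int, Q n.
Proof. by move=> Q1 n; rewrite -(subrK 1 n). Qed.

(** Serves to define maps out of a complex concentrated in the single degree [m]. *)
Lemma point_family (T : int -> Type) (b : forall n : int, T n) (m : int) (t : T m) :
  exists f : forall n : int, T n, f m = t /\ forall n : int, n <> m -> f n = b n.
Proof.
exists (fun n => if pselect (m = n) is left e then eq_rect m T t n e else b n).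
split=> [|n nm]; case: pselect => // e; last by case: nm.
by rewrite (Prop_irrelevance e erefl).
Qed.

(* Dependent choice along decreasing integers; keeping [n] and [n + 1] as the
   only indices avoids any transport along equalities of integers elsewhere. *)
Lemma descending_choice (T : int -> Type) (good : forall n : int, T n -> Prop)
    (R : forall n : int, T (n + 1) -> T n -> Prop) (N : int) (b : forall n : int, T n) :
  (forall n : int, N <= n -> good n (b n) /\ R n (b (n + 1)) (b n)) ->
  (forall (n : int) (t : T (n + 1)), good (n + 1) t -> exists2 t', good n t' & R n t t') ->
  exists f : forall n : int, T n, [/\ forall n : int, good n (f n),
    forall n : int, R n (f (n + 1)) (f n) & forall n : int, N < n -> f n = b n].
Proof.
move=> bP step.
pose next n (t : {t : T (n + 1) | good _ t}) : {t' : T n | good _ t' & R _ (sval t) t'} :=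
  cid2 (step n (sval t) (svalP t)).
pose U (k : nat) := {t : T (N - k%:Z) | good _ t}.
have eN : N = N - 0%:Z by rewrite subr0.
have eS k : N - k%:Z = N - k.+1%:Z + 1 by rewrite -addn1 PoszD opprD addrA subrK.
pose V (n : int) := {t : T n | good n t}.
(* [u k] is the value at [N - k], carried with a proof of [good] so that [step] applies again. *)
pose u := fix u k : U k := match k with
  | 0%N => eq_rect N V (exist _ (b N) (bP N (lexx N)).1) _ eN
  | k'.+1 => let t := next _ (eq_rect _ V (u k') _ (eS k')) in exist _ (s2val t) (s2valP t)
  end.
have uR k : R _ (sval (eq_rect _ V (u k) _ (eS k))) (sval (u k.+1)).
  by rewrite /=; case: (next _ _).
have key (n : int) : n <= N -> n = N - `|N - n|%:Z.
  by move=> nN; rewrite gez0_abs ?subr_ge0 // subKr.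
pose f (n : int) : T n := match boolP (n <= N) with
  | AltTrue h => sval (eq_rect _ V (u `|N - n|%N) _ (esym (key n h)))
  | AltFalse _ => b n end.
have fN (n : int) : N < n -> f n = b n.
  rewrite /f; case: {-}_ / boolP => // nN; by rewrite ltNge nN.
have fu k (n : int) (e : N - k%:Z = n) : f n = sval (eq_rect _ V (u k) _ e).
  have nN : n <= N by rewrite -e gerBl.
  rewrite /f; case: {-}_ / boolP => [h|]; last by rewrite nN.
  have ek : `|N - n|%N = k by rewrite -e subKr.
  move: (esym _); rewrite -> ek => e'; by rewrite (Prop_irrelevance e' e).
(* The two halves agree at [N]; this settles [R] at [n = N], where [f n] comes from [u] and
   [f (n + 1)] from [b]. *)
have fbN : f N = b N.
  rewrite (fu 0%N N (esym eN)) /=.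
  have castK (m : int) (e : N = m) (v : V N) :
      eq_rect m V (eq_rect N V v m e) N (esym e) = v by case: _ / e.
  by rewrite castK.
exists f; split=> // n.
  case: (ltP N n) => [Nn|nN]; first by rewrite fN //; case: (bP n (ltW Nn)).
  by rewrite (fu _ n (esym (key n nN))); case: (eq_rect _ _ _ _ _).
case: (ltP n N) => [nN|Nn]; last first.
  have -> : f n = b n by move: Nn; rewrite le_eqVlt => /orP[/eqP<-//|]; exact: fN.
  by rewrite fN ?ltzD1 //; case: (bP n Nn).
have [k e2] : exists k, N - k.+1%:Z = n.
  exists (absz (N - n - 1)%R).
  rewrite -addn1 PoszD gez0_abs ?subrK ?subKr //.
  by rewrite subr_ge0 -gtz0_ge1 subr_gt0.
have e1 : N - k%:Z = n + 1 by rewrite -e2 -eS.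
rewrite (fu _ _ e1) (fu _ _ e2); case: _ / e2 in e1 *.
by rewrite (Prop_irrelevance e1 (eS k)); exact: uR.
Qed.

(** * Complexes up to homotopy *)

Section HomotopyClasses.
Variable B : preadditive.
Implicit Types X Y Z : complex B.

Lemma khomW X Y (u : khom X Y) : exists f, u = kclass f.
Proof. by exists (repr u); rewrite kclass_repr. Qed.

Lemma kclass0 X Y : kclass (0 : chain_map X Y) = 0.
Proof. by apply: (addrI (kclass 0)); rewrite -kclassD !addr0. Qed.

Lemma kclass_eq0 X Y (f : chain_map X Y) : kclass f = 0 <-> null_homotopic f.
Proof. by rewrite -kclass0 kclassP subr0. Qed.

Lemma is_zero_idm (X : B) : idm X = 0 -> is_zero X.
Proof.
move=> X0; split=> Y f; first by rewrite -(comp1m f) X0 comp0m.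
by rewrite -(compm1 f) X0 compm0.
Qed.

Lemma chain_isomorphic X Y (f : forall n : int, hom (X n) (Y n))
    (g : forall n : int, hom (Y n) (X n)) :
  (forall n : int, g n \co f n = idm _) -> (forall n : int, f n \co g n = idm _) ->
  (forall n : int, cxd Y n \co f n = f (n + 1) \co cxd X n) ->
  isomorphic (X : Kminus B) Y.
Proof.
move=> gf fg df; have dg (n : int) : cxd X n \co g n = g (n + 1) \co cxd Y n.
  by rewrite -[LHS]comp1m -gf -ccompA (ccompA (f _)) -df -!ccompA fg compm1.
exists (kclass (ChainMap df)), (kclass (ChainMap dg)).
by split; rewrite /= kcompE; congr kclass; apply: chain_map_eq => n /=.
Qed.

(** Building a complex through [Proj] or directly in the heart changes only these proofs. *)
Lemma Complex_irrelevance (c : int -> B) (d : forall n : int, hom (c n) (c (n + 1)))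
    (dd dd' : forall n : int, d (n + 1) \co d n = 0)
    (b b' : exists N : int, forall n : int, N < n -> is_zero (c n)) :
  Complex dd b = Complex dd' b'.
Proof. by rewrite (Prop_irrelevance dd dd') (Prop_irrelevance b b'). Qed.

End HomotopyClasses.

(** * Fully faithful functors and homotopy categories *)

Section KminusMap.
Variables (A B : preadditive) (F : add_functor A B).
Hypotheses (Ffull : full F) (Ffaith : faithful F).

Lemma Kminus_map_faithful : faithful (Kminus_map F).
Proof.
move=> X Y u v; have [f ->] := khomW u; have [g ->] := khomW v.
rewrite /= !map_khomE => /kclassP[h hE]; apply/kclassP.
have /dependent_choice[k kE] (n : int) : exists k : hom (X (n + 1)) (Y n), fmap F k = h n by exact: Ffull.
exists k => n; apply: Ffaith; rewrite [RHS]fmapD !fmapM !kE -hE /=.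
by rewrite fmapD fmapN.
Qed.

Lemma Kminus_map_full : full (Kminus_map F).
Proof.
move=> X Y u; have [g ->] := khomW u.
have /dependent_choice[f fE] (n : int) : exists f : hom (X n) (Y n), fmap F f = g n by exact: Ffull.
have df (n : int) : cxd Y n \co f n = f (n + 1) \co cxd X n.
  by apply: Ffaith; rewrite !fmapM !fE; exact: (cmap_comm g n).
exists (kclass (ChainMap df)); rewrite /= map_khomE; congr kclass.
by apply: chain_map_eq => n /=.
Qed.

Lemma Kminus_map_ess_surjective : ess_surjective F -> ess_surjective (Kminus_map F).
Proof.
move=> Fes Y.
have /dependent_choice[X /dependent_choice[e /dependent_choice[e' ee']]] (n : int) : exists X, isomorphic (F X) (Y n) by exact: Fes.
have e'e n : e' n \co e n = idm _ := (ee' n).1.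
have {}ee' n : e n \co e' n = idm _ := (ee' n).2.
have /dependent_choice[d dE] (n : int) : exists d : hom (X n) (X (n + 1)),
  fmap F d = e' (n + 1) \co cxd Y n \co e n by exact: Ffull.
have dd (n : int) : d (n + 1) \co d n = 0.
  apply: Ffaith; rewrite fmapM !dE fmap0 -!ccompA (ccompA (e _)) ee' comp1m.
  by rewrite (ccompA (cxd Y _)) cxdd comp0m !compm0.
have bX : exists N : int, forall n : int, N < n -> is_zero (X n).
  case: (cx_bounded Y) => N YN; exists N => n /YN[_ Yn0]; apply: is_zero_idm.
  by apply: Ffaith; rewrite fmap1 fmap0 -e'e -(comp1m (e n)) (Yn0 _ (idm _)) comp0m compm0.
exists (Complex dd bX); apply: (@chain_isomorphic B (map_complex F (Complex dd bX)) Y e e' e'e ee') => n /=.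
by rewrite dE !ccompA ee' comp1m.
Qed.

End KminusMap.

(** * Lifting through maps that become quasi-isomorphisms under Hom *)

Section HomQuasiIso.
Variable B : preadditive.

(* For [W] satisfying [Pr], the map H^(n+1)(Hom(W, f)) is injective and surjective. *)
Definition hom_qis (Pr : B -> Prop) (X Y : complex B) (f : chain_map X Y) : Prop :=
  (forall W, Pr W -> forall (n : int) (x : hom W (X (n + 1))) (y : hom W (Y n)),
     cxd X (n + 1) \co x = 0 -> f (n + 1) \co x = cxd Y n \co y ->
     exists x', x = cxd X n \co x') /\
  (forall W, Pr W -> forall (n : int) (y : hom W (Y (n + 1))), cxd Y (n + 1) \co y = 0 ->
     exists (x : hom W (X (n + 1))) (y' : hom W (Y n)),
       cxd X (n + 1) \co x = 0 /\ y = f (n + 1) \co x + cxd Y n \co y').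

Variables (Pr : B -> Prop) (X Y : complex B) (f : chain_map X Y).
Hypothesis fqis : hom_qis Pr f.

(** This is exactness of Hom(W, cone f). Injectivity gives a first preimage [x0] of [x]; then
    [y - f x0] is a cycle, and surjectivity supplies the correction of [x0]. *)
Lemma cone_exact W (n : int) (x : hom W (X (n + 1 + 1))) (y : hom W (Y (n + 1))) : Pr W ->
  cxd X (n + 1 + 1) \co x = 0 -> f (n + 1 + 1) \co x = cxd Y (n + 1) \co y ->
  exists (x' : hom W (X (n + 1))) (y' : hom W (Y n)),
    x = cxd X (n + 1) \co x' /\ y = f (n + 1) \co x' + cxd Y n \co y'.
Proof.
case: fqis => inj surj PrW dx fx; have [x0 xE] := inj _ PrW _ _ _ dx fx.
have [|x1 [y1 [dx1 yE]]] := surj _ PrW n (y - f (n + 1) \co x0).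
  by rewrite comp_addr comp_oppr -fx xE !ccompA cmap_comm subrr.
exists (x0 + x1), y1; split; first by rewrite comp_addr dx1 addr0.
by rewrite comp_addr -addrA -yE addrC subrK.
Qed.

Variable P : complex B.
Hypothesis PrP : forall n : int, Pr (P n).

Lemma hom_qis_lift (g : chain_map P Y) :
  exists a : chain_map P X, null_homotopic (g - chain_comp f a).
Proof.
case: (cx_bounded P) => N P0.
have zP (n : int) (V : B) (v w : hom (P (n + 1)) V) : N <= n -> v = w.
  by move=> Nn; case: (P0 (n + 1)) => [|_ z]; rewrite ?ltzD1 // (z _ v) (z _ w).
pose T (n : int) : Type := prod (hom (P (n + 1)) (X (n + 1))) (hom (P (n + 1)) (Y n)).
(* [t.1] is the lift in degree [n + 1] and [t.2] the homotopy out of that degree. [good] says that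
   the pair of [t.1 \co cxd P n] and [g n - t.2 \co cxd P n] is a cycle of the cone, which
   [cone_exact] bounds in the next step. *)
pose good (n : int) (t : T n) : Prop := cxd X (n + 1) \co t.1 \co cxd P n = 0 /\
  (f (n + 1) \co t.1 + cxd Y n \co t.2 - g (n + 1)) \co cxd P n = 0.
pose R (n : int) (t' : T (n + 1)) (t : T n) :=
  t'.1 \co cxd P (n + 1) = cxd X (n + 1) \co t.1 /\
  g (n + 1) - t'.2 \co cxd P (n + 1) = f (n + 1) \co t.1 + cxd Y n \co t.2.
have [||t [_ tR _]] := @descending_choice T good R N (fun n : int => (0, 0)).
- move=> n Nn; split; last by split; exact: zP.
  split; first by rewrite compm0 comp0m.
  by rewrite /= !compm0 (zP _ _ (g _) 0 Nn) subr0 addr0 comp0m.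
- move=> n [a' h'] [/= da' fa'].
  have [|||a [h [aE hE]]] := @cone_exact (P (n + 1)) n (a' \co cxd P (n + 1))
    (g (n + 1) - h' \co cxd P (n + 1)); rewrite ?ccompA //.
    rewrite comp_addr comp_oppr cmap_comm ccompA.
    move/eqP: fa'; rewrite !comp_addl comp_oppl subr_eq0 => /eqP <-.
    by rewrite addrK.
  exists (a, h); split=> //=; rewrite -?hE -?aE.
    by rewrite -ccompA cxdd compm0.
  by rewrite addrAC subrr add0r comp_oppl -ccompA cxdd compm0 oppr0.
have [a aE] := @shift_family (fun n : int => hom (P n) (X n)) (fun n : int => (t n).1).
have da (n : int) : cxd X n \co a n = a (n + 1) \co cxd P n.
  by elim/forall_shift: n => n; rewrite !aE; case: (tR n).
exists (ChainMap da), (fun n : int => (t n).2) => n /=.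
have [_ /eqP] := tR n; rewrite aE subr_eq => /eqP->.
by rewrite [LHS]addrC -addrA addKr.
Qed.

Lemma hom_qis_faithful (u : chain_map P X) :
  null_homotopic (chain_comp f u) -> null_homotopic u.
Proof.
case=> k /= kE; case: (cx_bounded P) => N P0.
have zP (n : int) (V : B) (v w : hom (P (n + 1)) V) : N <= n -> v = w.
  by move=> Nn; case: (P0 (n + 1)) => [|_ z]; rewrite ?ltzD1 // (z _ v) (z _ w).
(* [t.1] is a component of the homotopy for [u]; [t.2] is a second-order homotopy comparing [k] with
   [f \co t.1], so that the cone condition holds again one degree lower. *)
pose T (n : int) : Type := prod (hom (P (n + 1 + 1)) (X (n + 1))) (hom (P (n + 1 + 1)) (Y n)).
pose good (n : int) (t : T n) : Prop := (u (n + 1 + 1) - cxd X (n + 1) \co t.1) \co cxd P (n + 1) = 0 /\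
  (k (n + 1) - f (n + 1) \co t.1 + cxd Y n \co t.2) \co cxd P (n + 1) = 0.
pose R (n : int) (t' : T (n + 1)) (t : T n) :=
  u (n + 1 + 1) = cxd X (n + 1) \co t.1 + t'.1 \co cxd P (n + 1 + 1).
have [||t [_ tR _]] := @descending_choice T good R N (fun n : int => (0, 0)).
- move=> n Nn; have Nn1 : N <= n + 1 by rewrite (le_trans Nn) // lerDl.
  split; last exact: zP.
  by rewrite /good (zP _ _ (cxd P (n + 1)) 0 Nn) !compm0.
- move=> n [h' m'] [/= dh' dm'].
  have [||h [m [hE mE]]] := @cone_exact (P (n + 1 + 1)) n
      (u (n + 1 + 1) - h' \co cxd P (n + 1 + 1))
      (k (n + 1) - m' \co cxd P (n + 1 + 1)) (PrP _).
  + by rewrite comp_addr comp_oppr cmap_comm ccompA -comp_oppl -comp_addl.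
  + rewrite !comp_addr !comp_oppr kE -[LHS]addrA; congr (_ + _).
    move/eqP: dm'; rewrite !comp_addl comp_oppl addr_eq0 => /eqP.
    by rewrite -!ccompA.
  exists (h, - m); last by rewrite /R /= -hE subrK.
  split=> /=; first by rewrite -hE subKr -ccompA cxdd compm0.
  have -> : k (n + 1) - f (n + 1) \co h + cxd Y n \co - m = m' \co cxd P (n + 1 + 1).
    by rewrite comp_oppr -[LHS]addrA -opprD -mE subKr.
  by rewrite -ccompA cxdd compm0.
have [h hE] := @shift_family (fun n : int => hom (P (n + 1)) (X n)) (fun n : int => (t n).1).
exists h => n; elim/forall_shift: n => n; rewrite !hE; exact: tR.
Qed.

Lemma hom_qis_bijective (u : hom (X : Kminus B) Y) : kclass f = u ->
  (forall g : hom (P : Kminus B) Y, exists a : hom (P : Kminus B) X, u \co a = g) /\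
  (forall a b : hom (P : Kminus B) X, u \co a = u \co b -> a = b).
Proof.
move=> <-{u}; split=> [g|a b].
  have [{}g ->] := khomW g; have [a ga] := hom_qis_lift g.
  by exists (kclass a); rewrite /= kcompE; apply/esym/kclassP.
have [{}a ->] := khomW a; have [{}b ->] := khomW b.
rewrite /= !kcompE => /kclassP fab; apply/kclassP/hom_qis_faithful.
congr null_homotopic : fab; apply: chain_map_eq => n /=.
by rewrite comp_addr comp_oppr.
Qed.

End HomQuasiIso.

(** * Localization *)

Section LocalizationEquivalence.
Variables (C D : category) (F : functor C D).
Variable W : forall X Y : D, hom X Y -> Prop.
Hypotheses (Ffull : full F) (Ffaith : faithful F).
Hypothesis W_surj : forall (P : C) (X Y : D) (s : hom X Y), W s ->
  forall g : hom (F P) Y, exists a : hom (F P) X, s \co a = g.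
Hypothesis W_inj : forall (P : C) (X Y : D) (s : hom X Y), W s ->
  forall a b : hom (F P) X, s \co a = s \co b -> a = b.
Hypothesis W_resolution : forall X : D, exists (P : C) (s : hom (F P) X), W s.

(* [Hom(F P, -)] inverts [W], hence acts on the formal composites. *)
Fixpoint fterm_act (P : C) (X Y : D) (t : fterm W X Y) : hom (F P) X -> hom (F P) Y :=
  match t with
  | fmor _ _ f => fun a => f \co a
  | finv _ _ _ sW => fun a => projT1 (cid (W_surj sW a))
  | fcomp _ _ _ t u => fun a => fterm_act t (fterm_act u a)
  end.

Lemma fterm_act_finv (P : C) (X Y : D) (s : hom X Y) (sW : W s) (a : hom (F P) Y) :
  s \co fterm_act (finv sW) a = a.
Proof. exact: projT2 (cid (W_surj sW a)). Qed.

(** The action descends to the localization. [W_inj] enters for the relation saying that the formal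
    inverse of [s] is a left inverse. *)
Lemma fterm_act_feq (P : C) (X Y : D) (t u : fterm W X Y) : feq t u ->
  forall a : hom (F P) X, fterm_act t a = fterm_act u a.
Proof.
move=> tu; elim: X Y t u / tu => //.
- by move=> X Y t u v _ tu _ uv a; rewrite tu uv.
- by move=> X Y Z t t' u u' _ tt' _ uu' a /=; rewrite uu' tt'.
- by move=> X Y t a /=; rewrite comp1m.
- by move=> X Y t a /=; rewrite comp1m.
- by move=> X Y Z g f a /=; rewrite ccompA.
- move=> X Y s sW a; apply: (W_inj sW).
  by rewrite (fterm_act_finv sW) /= comp1m.
- by move=> X Y s sW a; rewrite -[LHS]/(s \co fterm_act (finv sW) a) fterm_act_finv /= comp1m.
Qed.

(** A formal composite preceded by a morphism out of [F P] collapses to an honest morphism of [D];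
    with [a] the identity this yields fullness. *)
Lemma fterm_actE (P : C) (X Y : D) (t : fterm W X Y) (a : hom (F P) X) :
  feq (fmor W (fterm_act t a)) (fcomp t (fmor W a)).
Proof.
elim: t a => {X Y} [X Y f a|X Y s sW a|X Y Z t IHt u IHu a].
- exact: feq_mor.
- set b := fterm_act _ _.
  have aE : s \co b = a := fterm_act_finv sW a.
  rewrite -aE.
  apply: (feq_trans (feq_sym (feq_1l _))).
  apply: (feq_trans (feq_comp (feq_sym (feq_invl sW)) (feq_refl _))).
  apply: (feq_trans (feq_sym (feq_compA _ _ _))).
  by apply: feq_comp (feq_refl _) _; apply/feq_sym/feq_mor.
- apply: (feq_trans (IHt _)); apply: (feq_trans _ (feq_compA _ _ _)).
  exact: feq_comp (feq_refl _) (IHu _).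
Qed.

Lemma localization_equivalence : is_equivalence (functor_comp (loc_functor W) F).
Proof.
apply: equivalence_of_full_faithful.
- move=> P Q u; rewrite -(locrepr_class u).
  have [f fE] := Ffull (fterm_act (locrepr u) (idm (F P))).
  exists f; apply/locclassP; rewrite fE.
  exact: feq_trans (fterm_actE _ _) (feq_1r _).
- move=> P Q f g /locclassP/fterm_act_feq/(_ (idm (F P))) /=.
  by rewrite !compm1 => /Ffaith.
- move=> X; have [P [s sW]] := W_resolution X; exists P.
  exists (locclass (fmor W s)), (locclass (finv sW)).
  by split; rewrite /= loccompE; apply/locclassP; [exact: feq_invl|exact: feq_invr].
Qed.

End LocalizationEquivalence.

(** * Presented objects *)

Definition has_weak_kernels (B : preadditive) : Prop :=
  forall (X Y : B) (f : hom X Y), exists (K : B) (k : hom K X), f \co k = 0 /\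
    forall W (g : hom W X), f \co g = 0 -> exists h, k \co h = g.

Definition idempotents_split (B : preadditive) : Prop :=
  forall (X : B) (e : hom X X), e \co e = e ->
    exists (Y : B) (i : hom Y X) (r : hom X Y), r \co i = idm Y /\ i \co r = e.

Lemma kernel_mono (B : preadditive) (X Y K : B) (f : hom X Y) (k : hom K X) : is_kernel f k -> is_mono k.
Proof.
case=> fk kU Z u v uv; have [|w [_ wU]] := kU Z (k \co u).
  by rewrite ccompA fk comp0m.
by rewrite -(wU u) // -(wU v).
Qed.

Lemma cokernel_epi (B : preadditive) (X Y Q : B) (f : hom X Y) (c : hom Y Q) : is_cokernel f c -> is_epi c.
Proof.
case=> cf cU Z u v uv; have [|w [_ wU]] := cU Z (u \co c).
  by rewrite -ccompA cf compm0.
by rewrite -(wU u) // -(wU v).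
Qed.

(** A weak kernel of [f \co p1 - g \co p2] on a biproduct does it. *)
Lemma weak_pullback (B : preadditive) (X Y Z : B) (f : hom X Z) (g : hom Y Z) :
  is_additive B -> has_weak_kernels B ->
  exists (K : B) (a : hom K X) (b : hom K Y), f \co a = g \co b /\
    forall W (u : hom W X) (v : hom W Y), f \co u = g \co v ->
      exists h, a \co h = u /\ b \co h = v.
Proof.
move=> addB wkB; have [S [i1 [i2 [p1 [p2 [pi11 pi22 pi12 pi21 _]]]]]] := has_biproducts addB X Y.
have [K [k [k0 kU]]] := wkB _ _ (f \co p1 - g \co p2).
exists K, (p1 \co k), (p2 \co k); split.
  by apply/eqP; rewrite !ccompA -subr_eq0 -comp_oppl -comp_addl k0.
move=> W u v fugv; have [|h hE] := kU W (i1 \co u + i2 \co v).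
  rewrite comp_addl !comp_oppl !comp_addr -!ccompA !(ccompA p1) !(ccompA p2).
  rewrite pi11 pi22 pi12 pi21 !comp0m !comp1m !compm0 addr0 add0r fugv.
  exact: subrr.
exists h; rewrite -!ccompA hE !comp_addr !ccompA pi11 pi22 pi12 pi21.
by rewrite !comp0m !comp1m addr0 add0r.
Qed.

Section Presentations.
Variables (B H : preadditive) (P : add_functor B H).

(* If [H] is the category of finitely presented functors on [B] and [P] the Yoneda
   embedding, this says that [X] is the cokernel of [Hom(-, m)]. *)
Record presents (M1 M0 : B) (m : hom M1 M0) (X : H) (q : hom (P M0) X) : Prop := Presents {
  presents_comp0 : q \co fmap P m = 0;
  presents_factor : forall Y (u : hom (P M0) Y), u \co fmap P m = 0 ->
    exists v : hom X Y, v \co q = u;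
  presents_epi : is_epi q;
  presents_lift : forall W (x : hom (P W) X), exists w : hom W M0, q \co fmap P w = x;
  presents_kernel : forall W (w : hom W M0), q \co fmap P w = 0 ->
    exists c : hom W M1, w = m \co c }.

Hypotheses (addB : is_additive B) (wkB : has_weak_kernels B) (splitB : idempotents_split B).
Hypotheses (Pfull : full P) (Pfaith : faithful P).
Hypothesis presented : forall X : H, exists (M1 M0 : B) (m : hom M1 M0) (q : hom (P M0) X),
  presents m q.
Hypothesis presenting : forall (M1 M0 : B) (m : hom M1 M0), exists (X : H) (q : hom (P M0) X),
  presents m q.

(** Morphisms [P W -> X] serve as elements of [X]; the presenting epimorphism is itself one of
    them. *)
Lemma eq_on_elements (X Y : H) (u v : hom X Y) :
  (forall W (x : hom (P W) X), u \co x = v \co x) -> u = v.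
Proof. by move=> uv; have [M1 [M0 [m [q qm]]]] := presented X; apply: (presents_epi qm). Qed.

Lemma mono_on_elements (X Y : H) (k : hom X Y) :
  (forall W (x : hom (P W) X), k \co x = 0 -> x = 0) -> is_mono k.
Proof.
move=> k0 Z u v kuv; apply: eq_on_elements => W x; apply/eqP; rewrite -subr_eq0; apply/eqP/k0.
by rewrite comp_addr comp_oppr !ccompA kuv subrr.
Qed.

(** [K0] weakly covers the elements of [M0] that [f0] sends into the image of [n], that is, to zero
    in [Y]; [K1] covers those that moreover come from [M1], hence vanish in [X]. The kernel is
    presented by [K1 -> K0]. *)
Lemma kernel_exists (X Y : H) (f : hom X Y) : exists (K : H) (k : hom K X), is_kernel f k.
Proof.
have [M1 [M0 [m [q qm]]]] := presented X; have [N1 [N0 [n [r rn]]]] := presented Y.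
have [f0 f0E] := presents_lift rn (f \co q).
have [K0 [al [ga [alga K0U]]]] := weak_pullback f0 n addB wkB.
have [K1 [be [de [bede K1U]]]] := weak_pullback al m addB wkB.
have [K [p pbe]] := presenting be.
have [|k kE] := presents_factor pbe (u := q \co fmap P al).
  by rewrite -ccompA -fmapM bede fmapM ccompA (presents_comp0 qm) comp0m.
have kmono : is_mono k.
  apply: mono_on_elements => W x; have [w <-] := presents_lift pbe x.
  rewrite ccompA kE -ccompA -fmapM => /(presents_kernel qm)[c /K1U[h [<- _]]].
  by rewrite fmapM ccompA (presents_comp0 pbe) comp0m.
have fk : f \co k = 0.
  apply: (presents_epi pbe); rewrite comp0m -ccompA kE ccompA -f0E -ccompA -fmapM alga.
  by rewrite fmapM ccompA (presents_comp0 rn) comp0m.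
exists K, k; split=> // V g fg.
have [L1 [L0 [l [s sl]]]] := presented V; have [g0 g0E] := presents_lift qm (g \co s).
have [c /K0U[e [eE _]]] : exists c, f0 \co g0 = n \co c.
  by apply: (presents_kernel rn); rewrite fmapM ccompA f0E -ccompA g0E ccompA fg comp0m.
have [|h hE] := presents_factor sl (u := p \co fmap P e).
  apply: kmono; rewrite compm0 !ccompA kE -(ccompA q) -fmapM eE g0E -ccompA.
  by rewrite (presents_comp0 sl) compm0.
have kh : k \co h = g.
  by apply: (presents_epi sl); rewrite -ccompA hE ccompA kE -ccompA -fmapM eE.
by exists h; split=> // h' kh'; apply: kmono; rewrite kh.
Qed.

(** With [f0] a lift of [f] to the presentations, the cokernel is presented by the map from the
    biproduct of [M0] and [N1] to [N0] with components [f0] and [n]. The last clause, exactness on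
    elements, is the source of the projectivity of [P M]. *)
Lemma cokernel_exists (X Y : H) (f : hom X Y) : exists (Q : H) (c : hom Y Q), is_cokernel f c /\
  forall W (y : hom (P W) Y), c \co y = 0 -> exists x, y = f \co x.
Proof.
have [M1 [M0 [m [q qm]]]] := presented X; have [N1 [N0 [n [r rn]]]] := presented Y.
have [f0 f0E] := presents_lift rn (f \co q).
have [S [i1 [i2 [p1 [p2 [pi11 pi22 pi12 pi21 _]]]]]] := has_biproducts addB M0 N1.
pose g := f0 \co p1 + n \co p2.
have gi1 : g \co i1 = f0 by rewrite comp_addl -!ccompA pi11 pi21 compm0 compm1 addr0.
have gi2 : g \co i2 = n by rewrite comp_addl -!ccompA pi12 pi22 compm0 compm1 add0r.
have [Q [p pg]] := presenting g.
have pf0 : p \co fmap P f0 = 0 by rewrite -gi1 fmapM ccompA (presents_comp0 pg) comp0m.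
have [|c cE] := presents_factor rn (u := p).
  by rewrite -gi2 fmapM ccompA (presents_comp0 pg) comp0m.
have cepi : is_epi c.
  move=> Z u v /(congr1 (fun w => w \co r)); rewrite -!ccompA cE; exact: (presents_epi pg).
have cf : c \co f = 0.
  by apply: (presents_epi qm); rewrite comp0m -ccompA -f0E ccompA cE.
have rg : r \co fmap P g = f \co q \co fmap P p1.
  by rewrite fmapD comp_addr !fmapM !ccompA f0E (presents_comp0 rn) comp0m addr0.
exists Q, c; split; [split=> // V h hf|move=> W y].
  have [|v vE] := presents_factor pg (u := h \co r).
    by rewrite -ccompA rg !ccompA hf !comp0m.
  have vc : v \co c = h by apply: (presents_epi rn); rewrite -ccompA cE.
  by exists v; split=> // v' v'c; apply: cepi; rewrite vc.
have [w <-] := presents_lift rn y; rewrite ccompA cE => /(presents_kernel pg)[d ->].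
by exists (q \co fmap P (p1 \co d)); rewrite !fmapM !ccompA rg.
Qed.

Lemma cokernel_exact (X Y Q : H) (f : hom X Y) (c : hom Y Q) : is_cokernel f c ->
  forall W (y : hom (P W) Y), c \co y = 0 -> exists x, y = f \co x.
Proof.
case=> _ cU W y cy; have [Q' [c' [[c'f _] ex]]] := cokernel_exists f.
have [v [vc _]] := cU _ _ c'f.
by apply: ex; rewrite -vc -ccompA cy compm0.
Qed.

(** The cokernel map of an epimorphism is zero, so exactness on elements puts every [f] in the image
    of [e]. *)
Lemma P_projective M : is_projective (P M).
Proof.
move=> X Y e f eepi; have [Q [c [[ce _] ex]]] := cokernel_exists e.
have c0 : c = 0 by apply: eepi; rewrite ce comp0m.
by have [|g ->] := ex _ f; [rewrite c0 comp0m|exists g].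
Qed.

Lemma presented_enough_projectives : enough_projectives H.
Proof.
move=> X; have [M1 [M0 [m [q qm]]]] := presented X.
by exists (P M0), q; split; [exact: P_projective|exact: presents_epi qm].
Qed.

(** A projective [X] is a retract of [P M0]; the resulting idempotent comes from one on [M0], which
    splits in [B]. *)
Lemma projective_isomorphic (X : H) : is_projective X -> exists M : B, isomorphic (P M) X.
Proof.
move=> projX; have [M1 [M0 [m [q qm]]]] := presented X.
have [s qs] := projX _ _ _ (idm X) (presents_epi qm).
have [e eE] := Pfull (s \co q).
have [|M [i [r [ri ir]]]] := splitB (e := e).
  by apply: Pfaith; rewrite fmapM eE ccompA -(ccompA s) qs compm1.
exists M, (q \co fmap P i), (fmap P r \co s); split.
  rewrite ccompA -(ccompA _ s) -eE -!fmapM -ir ccompA ri comp1m ri; exact: fmap1.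
by rewrite ccompA -(ccompA q) -fmapM ir eE ccompA qs comp1m qs.
Qed.

(** Lifting the presenting map of [Y] through [u] and factoring the lift through [Y] gives a right
    inverse; a monomorphism with a right inverse is invertible. *)
Lemma is_iso_on_elements (X Y : H) (u : hom X Y) :
  (forall W (x : hom (P W) X), u \co x = 0 -> x = 0) ->
  (forall W (y : hom (P W) Y), exists x, y = u \co x) -> is_iso u.
Proof.
move=> /mono_on_elements umono usurj.
have [N1 [N0 [n [r rn]]]] := presented Y; have [a aE] := usurj _ r.
have [|v vE] := presents_factor rn (u := a).
  by apply: umono; rewrite compm0 ccompA -aE (presents_comp0 rn).
have uv : u \co v = idm Y by apply: (presents_epi rn); rewrite -ccompA vE -aE comp1m.
by exists v; split=> //; apply: umono; rewrite ccompA uv comp1m compm1.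
Qed.

(** * Quasi-isomorphisms detected by the objects [P M] *)

Definition represented (X : H) : Prop := exists M : B, X = P M.

Lemma cohomology_exists (X : complex H) n : exists _ : cohomology X n, True.
Proof.
have [Z [i iK]] := kernel_exists (cxd X (n + 1)).
have [b [bE _]] := iK.2 _ _ (cxdd X n).
have [Q [c [cQ _]]] := cokernel_exists b.
by exists (Cohomology iK bE cQ).
Qed.

Lemma cohomology_map_exists (X Y : complex H) (f : chain_map X Y) n
    (HX : cohomology X n) (HY : cohomology Y n) :
  exists (z : hom (cyc HX) (cyc HY)) (h : hom (coh HX) (coh HY)),
    cyc_in HY \co z = f (n + 1) \co cyc_in HX /\ h \co coh_pr HX = coh_pr HY \co z.
Proof.
have [|z [zE _]] := (cyc_kernel HY).2 _ (f (n + 1) \co cyc_in HX).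
  by rewrite ccompA cmap_comm -ccompA (cyc_kernel HX).1 compm0.
have [|h [hE _]] := (coh_cokernel HX).2 _ (coh_pr HY \co z); last by exists z, h.
have zb : z \co bnd HX = bnd HY \co f n.
  apply: (kernel_mono (cyc_kernel HY)).
  by rewrite !ccompA zE bndE -ccompA bndE cmap_comm.
by rewrite -ccompA zb ccompA (coh_cokernel HY).1 comp0m.
Qed.

(** As [P M] is projective, Hom(P M, -) is exact and commutes with cohomology. *)
Lemma chain_qis_hom_qis (X Y : complex H) (f : chain_map X Y) :
  chain_qis f -> hom_qis represented f.
Proof.
move=> fqis; split=> _ [M ->] n.
  move=> x y dx fx.
  have [HX _] := cohomology_exists X n; have [HY _] := cohomology_exists Y n.
  have [z [h [zE hE]]] := cohomology_map_exists f HX HY.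
  have [h' [h'h _]] := fqis _ _ _ _ _ zE hE.
  have [x0 [x0E _]] := (cyc_kernel HX).2 _ _ dx.
  have zx0 : z \co x0 = bnd HY \co y.
    apply: (kernel_mono (cyc_kernel HY)).
    by rewrite !ccompA zE bndE -ccompA x0E.
  have [|x' x'E] := cokernel_exact (coh_cokernel HX) (y := x0).
    rewrite -[LHS]comp1m -h'h -ccompA (ccompA h) hE -(ccompA _ z) zx0 (ccompA (coh_pr HY)).
    by rewrite (coh_cokernel HY).1 comp0m compm0.
  by exists x'; rewrite -x0E x'E ccompA bndE.
move=> y dy.
have [HX _] := cohomology_exists X n; have [HY _] := cohomology_exists Y n.
have [z [h [zE hE]]] := cohomology_map_exists f HX HY.
have [h' [_ hh']] := fqis _ _ _ _ _ zE hE.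
have [y0 [y0E _]] := (cyc_kernel HY).2 _ _ dy.
have [x0 x0E] := P_projective (h' \co coh_pr HY \co y0) (cokernel_epi (coh_cokernel HX)).
have [|y' y'E] := cokernel_exact (coh_cokernel HY) (y := y0 - z \co x0).
  rewrite comp_addr comp_oppr ccompA -hE -ccompA x0E !ccompA hh' comp1m; exact: subrr.
exists (cyc_in HX \co x0), y'; split; first by rewrite ccompA (cyc_kernel HX).1 comp0m.
by rewrite -(bndE HY) -(ccompA _ _ y') -y'E comp_addr comp_oppr y0E !ccompA zE [RHS]addrC subrK.
Qed.

(** Elements of the cohomology lift to cycles because [P W] is projective, so bijectivity of [h] can
    be tested on elements. *)
Lemma hom_qis_chain_qis (X Y : complex H) (f : chain_map X Y) :
  hom_qis represented f -> chain_qis f.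
Proof.
case=> inj surj n HX HY z h zE hE; apply: is_iso_on_elements => W c.
  have [c0 <-] := P_projective c (cokernel_epi (coh_cokernel HX)).
  rewrite ccompA hE -ccompA => /(cokernel_exact (coh_cokernel HY))[y yE].
  have [|||x xE] := inj (P W) _ n (cyc_in HX \co c0) y; first by exists W.
  - by rewrite ccompA (cyc_kernel HX).1 comp0m.
  - by rewrite ccompA -zE -ccompA yE ccompA bndE.
  have -> : c0 = bnd HX \co x.
    by apply: (kernel_mono (cyc_kernel HX)); rewrite xE ccompA bndE.
  by rewrite ccompA (coh_cokernel HX).1 comp0m.
have [c0 <-] := P_projective c (cokernel_epi (coh_cokernel HY)).
have [||x [y [dx E]]] := surj (P W) _ n (cyc_in HY \co c0); first by exists W.
  by rewrite ccompA (cyc_kernel HY).1 comp0m.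
have [x0 [x0E _]] := (cyc_kernel HX).2 _ _ dx.
exists (coh_pr HX \co x0).
have -> : c0 = z \co x0 + bnd HY \co y.
  apply: (kernel_mono (cyc_kernel HY)).
  by rewrite E comp_addr !ccompA zE bndE -ccompA x0E.
by rewrite comp_addr !ccompA (coh_cokernel HY).1 comp0m addr0 hE.
Qed.

(** * Resolutions by complexes over [B] *)

Record resolution_step (V : H) := ResolutionStep {
  step_ob : B;
  step_cod : B;
  step_diff : hom step_ob step_cod;
  step_map : hom (P step_ob) V }.

(* The new term weakly covers the pullback over [V'] of [V] and the cycles of [s'].
   Its cycles are read off from [step_diff s], as [d] is only available afterwards. *)
Definition resolution_rel (V' V : H) (e : hom V V')
    (s' : resolution_step V') (s : resolution_step V) (d : hom (step_ob s) (step_ob s')) :=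
  [/\ step_diff s' \co d = 0,
    forall W (w : hom W (step_ob s)), d \co w = 0 <-> step_diff s \co w = 0,
    e \co step_map s = step_map s' \co fmap P d &
    forall W (x : hom (P W) V) (z : hom W (step_ob s')), step_diff s' \co z = 0 ->
      e \co x = step_map s' \co fmap P z ->
      exists w, step_map s \co fmap P w = x /\ d \co w = z].

(** [K0] weakly covers the cycles of [d1], and [K] is a weak pullback over [N0] of [K0] and the
    biproduct of [L0] and [N1]. The summand [N1] is there because equality in [V'] only means
    equality in [N0] modulo the image of [nu]. *)
Lemma resolution_step_exists (V' V : H) (e : hom V V') (s' : resolution_step V') :
  exists s d, @resolution_rel _ _ e s' s d.
Proof.
case: s' => M1 M2 d1 p1; rewrite /resolution_rel /=.
have [L1 [L0 [l [q ql]]]] := presented V; have [N1 [N0 [nu [r rnu]]]] := presented V'.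
have [de deE] := presents_lift rnu (e \co q); have [pi piE] := presents_lift rnu p1.
have [K0 [ka [ka0 kaU]]] := wkB d1.
have [S [i1 [i2 [p1' [p2 [pi11 pi22 pi12 pi21 _]]]]]] := has_biproducts addB L0 N1.
pose g := de \co p1' + nu \co p2.
have [K [a [b [ab KU]]]] := weak_pullback (pi \co ka) g addB wkB.
have rg : r \co fmap P g = r \co fmap P de \co fmap P p1'.
  by rewrite fmapD comp_addr !fmapM !ccompA (presents_comp0 rnu) comp0m addr0.
exists (ResolutionStep (ka \co a) (q \co fmap P (p1' \co b))), (ka \co a); split=> //=.
- by rewrite ccompA ka0 comp0m.
- have -> : p1 \co fmap P (ka \co a) = r \co fmap P g \co fmap P b.
    by rewrite -piE -!ccompA -!fmapM ccompA ab.
  by rewrite rg deE fmapM !ccompA.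
move=> W x z dz; have [x0 <-] := presents_lift ql x; have [k <-] := kaU _ _ dz.
rewrite ccompA -deE -piE -!ccompA -!fmapM => /eqP; rewrite eq_sym -subr_eq0 => /eqP E.
have [c cE] : exists c, pi \co (ka \co k) - de \co x0 = nu \co c.
  by apply: (presents_kernel rnu); rewrite fmapD fmapN comp_addr comp_oppr.
have [|h [ah bh]] := KU _ k (i1 \co x0 + i2 \co c).
  rewrite comp_addr !comp_addl -!ccompA !(ccompA p1') !(ccompA p2) pi11 pi22 pi12 pi21.
  rewrite !comp0m !comp1m !compm0 addr0 add0r -cE.
  by rewrite [RHS]addrC subrK.
exists h; rewrite -!ccompA ah -!fmapM -!ccompA bh comp_addr !ccompA pi11 pi12.
by rewrite comp1m comp0m addr0.
Qed.

Lemma projective_resolution (X : complex H) :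
  exists (Y : complex B) (p : chain_map (map_complex P Y) X), hom_qis represented p.
Proof.
have [Z Z0] := has_zero addB; case: (cx_bounded X) => N XN.
pose T (n : int) := resolution_step (X n).
pose R (n : int) (s' : T (n + 1)) (s : T n) := exists d, @resolution_rel _ _ (cxd X n) s' s d.
pose b (n : int) : T n := @ResolutionStep _ Z Z 0 0.
(* From degree [N + 1] on [X] vanishes, so the zero step meets the covering condition. *)
have [||s [_ sR sb]] := @descending_choice T (fun _ _ => True) R (N + 1) b.
- move=> n Nn; split=> //; exists 0; split=> /=.
  + by rewrite compm0.
  + by move=> W w; rewrite comp0m.
  + by rewrite compm0 comp0m.
  move=> W x z _ _; exists 0; split; last by rewrite comp0m; case: Z0 => Z0 _; rewrite (Z0 _ z).
  by rewrite comp0m; case: (XN n) => [|Xn0 _]; rewrite ?(Xn0 _ x) -?lezD1.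
- move=> n s' _; have [s [d sd]] := resolution_step_exists (cxd X n) s'.
  by exists s => //; exists d.
have {sR}[d dR] := dependent_choice sR.
have dd (n : int) : d (n + 1) \co d n = 0.
  by have [sd _ _ _] := dR n; have [_ dsd _ _] := dR (n + 1); apply/dsd.
have Yb : exists M : int, forall n : int, M < n -> is_zero (step_ob (s n)).
  by exists (N + 1) => n Nn; rewrite sb.
pose Y := Complex dd Yb.
have pd (n : int) : cxd X n \co step_map (s n) = step_map (s (n + 1)) \co cxd (map_complex P Y) n.
  by have [_ _ ? _] := dR n.
exists Y, (@ChainMap _ (map_complex P Y) X _ pd); split=> _ [W ->] n /=.
  move=> x y; have [x0 <-] := Pfull x; rewrite -fmapM -(fmap0 P) => /Pfaith dx /esym xy.
  have [_ /(_ _ x0) [sd _] _ _] := dR (n + 1).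
  have [_ _ _ /(_ _ y x0 (sd dx) xy)[w [_ dw]]] := dR n.
  by exists (fmap P w); rewrite -fmapM dw.
(* A cycle [y] is covered as the pair of [y] and 0, so no boundary has to be added. *)
move=> y dy; have [_ _ _ /(_ _ y 0)[||w [wE dw]]] := dR (n + 1).
- by rewrite compm0.
- by rewrite dy fmap0 compm0.
by exists (fmap P w), 0; rewrite compm0 addr0 wE -fmapM dw fmap0.
Qed.

End Presentations.

(** * Consequences of the approximation property *)

(** The image of [e] is the kernel of [idm X - e], and its complement is the kernel of [e]. The
    complement is kept because [karoubi_closed] speaks of biproducts. *)
Lemma abelian_split (A : preadditive) (abA : is_abelian A) (X : A) (e : hom X X) :
  e \co e = e -> exists (Y Y' : A) (i : hom Y X) (r : hom X Y),
    [/\ r \co i = idm Y, i \co r = e & is_biproduct Y Y' X].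
Proof.
move=> ee; have [K [k kK]] := has_kernels abA (idm X - e).
have [K' [k' kK']] := has_kernels abA e.
have [|r [rE _]] := kK.2 _ e; first by rewrite comp_addl comp_oppl comp1m ee subrr.
have [|r' [rE' _]] := kK'.2 _ (idm X - e).
  by rewrite comp_addr comp_oppr compm1 ee subrr.
have kmono := kernel_mono kK; have kmono' := kernel_mono kK'.
have ek : e \co k = k.
  by apply/esym/eqP; rewrite -subr_eq0 -{1}(comp1m k) -comp_oppl -comp_addl kK.1.
have rk : r \co k = idm K by apply: kmono; rewrite ccompA rE ek compm1.
have rk' : r' \co k' = idm K'.
  by apply: kmono'; rewrite ccompA rE' comp_addl comp_oppl kK'.1 subr0 comp1m compm1.
exists K, K', k, r; split=> //; exists k, k', r, r'; split=> //.
- by apply: kmono; rewrite ccompA rE kK'.1 compm0.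
- by apply: kmono'; rewrite ccompA rE' kK.1 compm0.
by rewrite rE rE' [LHS]addrC subrK.
Qed.

Section Approximating.
Variables (A : preadditive) (abA : is_abelian A) (C : A -> Prop).
Hypotheses (addC : is_additive (fullsub C)) (karC : karoubi_closed C) (approxC : approximating C).

(** The precover is the degree 0 component of an approximation of the stalk complex of [X]; a map
    [W -> X] lifts as a map of stalk complexes. *)
Lemma approximating_precover (X : A) : exists (M : fullsub C) (p : hom (sval M) X),
  forall (W : fullsub C) (g : hom (sval W) X), exists h : hom W M, p \co (h : hom (sval W) (sval M)) = g.
Proof.
have [XC [f [_ fbij]]] := approxC (stalk (abelian_additive abA) X).
have [f' f'E] := khomW f; exists (XC 0), (f' 0) => W g.
pose G (n : int) : hom (map_complex (fullsub_incl C) (stalk addC W) n)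
    (stalk (abelian_additive abA) X n) := match n with Posz 0 => g | _ => 0 end.
have dG (n : int) : cxd (stalk (abelian_additive abA) X) n \co G n =
    G (n + 1) \co cxd (map_complex (fullsub_incl C) (stalk addC W)) n.
  by rewrite /= comp0m; apply: esym; exact: compm0.
have [v _ /(_ (kclass (ChainMap dG)))] := fbij (stalk addC W).
have [u uE] := khomW (v (kclass (ChainMap dG))).
(* The index [Negz 0] reads the homotopy relation in degree 0, where both homotopy terms vanish
   because stalk complexes have zero differentials. *)
rewrite uE f'E /= map_khomE kcompE => /kclassP[h /(_ (Negz 0)) hE].
exists (u 0); apply/eqP; rewrite -subr_eq0; apply/eqP.
move: hE => /=; rewrite comp0m add0r => hE; apply: (etrans hE); exact: compm0.
Qed.

(** A precover by [C] of the kernel taken in [A] is a weak kernel in [C]. *)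
Lemma approximating_weak_kernels : has_weak_kernels (fullsub C).
Proof.
move=> X Y f; have [K [k [fk kU]]] := has_kernels abA (f : hom (sval X) (sval Y)).
have [M [p pU]] := approximating_precover K.
exists M, (k \co p); split; first by rewrite /= ccompA fk comp0m.
move=> W g fg; have [g' [g'E _]] := kU _ (g : hom (sval W) (sval X)) fg.
have [h hE] := pU _ g'; exists h.
by rewrite /= -ccompA hE.
Qed.

Lemma karoubi_idempotents_split : idempotents_split (fullsub C).
Proof.
move=> X e ee.
have [Y [Y' [i [r [ri ir bip]]]]] := abelian_split abA (e := (e : hom (sval X) (sval X))) ee.
by exists (exist _ Y (karC bip (svalP X))), i, r.
Qed.

End Approximating.

(** * Complexes with Hom exact in negative degrees, and the coconnective part of the t-structure *)

Section NegativelyExact.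
Variable B : preadditive.
Implicit Types X Y Z : complex B.

Definition nonpositive X : Prop := forall n : int, 0 < n -> is_zero (X n).

(** [Negz k.+1 + 1] runs through -1, -2, and so on: Hom(W, Y) is exact in strictly negative degrees,
    with no condition in degree 0. *)
Definition neg_exact Y : Prop := forall (k : nat) W (z : hom W (Y (Negz k.+1 + 1))),
  cxd Y (Negz k.+1 + 1) \co z = 0 -> exists w, z = cxd Y (Negz k.+1) \co w.

Lemma nonpositive_eq X (n : int) (V : B) (v w : hom (X (n + 1)) V) :
  nonpositive X -> 0 <= n -> v = w.
Proof.
by move=> X0 n0; case: (X0 (n + 1)) => [|_ z]; rewrite ?ltzD1 // (z _ v) (z _ w).
Qed.

(** Starting from [w] in degree 0, what remains of [f] one degree lower after subtracting the known
    homotopy term is a cycle, and exactness of [Y] yields the next component. *)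
Lemma null_extension X Y (f : chain_map X Y) (w : hom (X (Negz 0 + 1)) (Y (Negz 0))) :
  nonpositive X -> neg_exact Y -> f (Negz 0 + 1) = cxd Y (Negz 0) \co w -> null_homotopic f.
Proof.
move=> X0 Yex fw.
pose T (n : int) := hom (X (n + 1)) (Y n).
pose good (n : int) (h : T n) := (f (n + 1) - cxd Y n \co h) \co cxd X n = 0.
pose R (n : int) (h' : T (n + 1)) (h : T n) :=
  f (n + 1) = cxd Y n \co h + h' \co cxd X (n + 1).
have [||h [_ hR _]] := @descending_choice T good R 0 (fun n => 0).
- move=> n n0; split; last exact: nonpositive_eq.
  by rewrite /good (nonpositive_eq (f (n + 1)) 0 X0 n0) compm0 subrr comp0m.
(* Three ranges of the index: from 0 on the source vanishes, at -1 the given [w] is taken, and below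
   that exactness applies. *)
- case=> [k|[|k]] h' gh'.
  + exists 0; last exact: nonpositive_eq.
    by rewrite /good (nonpositive_eq (f (Posz k + 1)) 0) // compm0 subrr comp0m.
  + exists w; first by rewrite /good fw (subrr (cxd Y (Negz 0) \co w)) comp0m.
    by rewrite /R (nonpositive_eq h' 0) // comp0m addr0.
  have [|h hE] := Yex k _ (f (Negz k.+1 + 1) - h' \co cxd X (Negz k.+1 + 1)).
    rewrite comp_addr comp_oppr cmap_comm ccompA -comp_oppl -comp_addl; exact: gh'.
  exists h; last by rewrite /R -hE subrK.
  by rewrite /good -hE subKr -ccompA cxdd compm0.
by exists h.
Qed.

(** Each component is chosen so that a next one exists: composed with the differential of [X] it is
    a cycle of [Y], hence a boundary. *)
Lemma map_extension X Y (g : hom (X (Negz 0 + 1)) (Y (Negz 0 + 1))) (w : hom (X (Negz 0)) (Y (Negz 0))) :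
  nonpositive X -> nonpositive Y -> neg_exact Y ->
  g \co cxd X (Negz 0) = cxd Y (Negz 0) \co w ->
  exists f : chain_map X Y, f (Negz 0 + 1) = g.
Proof.
move=> X0 Y0 Yex gw.
pose T (n : int) := hom (X (n + 1)) (Y (n + 1)).
(* Forces the component in degree 0, stored at index -1, to be [g]. *)
pose pin (n : int) : T n -> Prop := match n with Negz 0 => fun t => t = g | _ => fun=> True end.
pose good (n : int) (t : T n) := pin n t /\ exists w, t \co cxd X n = cxd Y n \co w.
pose R (n : int) (t' : T (n + 1)) (t : T n) :=
  t' \co cxd X (n + 1) = cxd Y (n + 1) \co t.
have [||t [tgood tR _]] := @descending_choice T good R 0 (fun n => 0).
- move=> n n0; split; last exact: nonpositive_eq.
  split; first by case: n n0 => // -[].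
  by exists 0; rewrite comp0m compm0.
- case=> [k|[|k]] t' [_ [v vE]].
  + exists 0; last exact: nonpositive_eq.
    by split=> //; exists 0; rewrite comp0m compm0.
  + exists g; first by split=> //; exists w.
    by rewrite /R (nonpositive_eq t' 0) // comp0m; case: (Y0 (Negz 0 + 1 + 1)) => // -> _.
  exists v => //; split=> //; have [|u uE] := Yex k _ (v \co cxd X (Negz k.+1)); last by exists u.
  by rewrite ccompA -vE -ccompA cxdd compm0.
have [f fE] := @shift_family (fun n => hom (X n) (Y n)) t.
have df (n : int) : cxd Y n \co f n = f (n + 1) \co cxd X n.
  by elim/forall_shift: n => n; rewrite !fE tR.
by exists (ChainMap df); rewrite /= (fE (Negz 0)); case: (tgood (Negz 0)).
Qed.

Lemma iso_T_ge0 (X Y : Kminus B) : isomorphic X Y -> T_ge0 X -> T_ge0 Y.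
Proof.
case=> a [b [_ ab]] X0 Z f Z0.
by rewrite -(comp1m f) -ab -ccompA (X0 _ (b \co f) Z0) compm0.
Qed.

Lemma nonpositive_T_le0 X : nonpositive X -> T_le0 (X : Kminus B).
Proof. by move=> X0; exists X; split=> //; exact: isomorphic_refl. Qed.

Lemma chain_shift_comm X Y (f : chain_map X Y) (n : int) :
  cxd (shift Y) n \co f (n + 1) = f (n + 1 + 1) \co cxd (shift X) n.
Proof. by rewrite /= comp_oppl comp_oppr cmap_comm. Qed.

Definition chain_shift X Y (f : chain_map X Y) : chain_map (shift X) (shift Y) :=
  @ChainMap B (shift X) (shift Y) (fun n : int => f (n + 1)) (chain_shift_comm f).

Lemma null_shift X Y (f : chain_map X Y) : null_homotopic f -> null_homotopic (chain_shift f).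
Proof.
case=> h hE; exists (fun n => - h (n + 1)) => n /=.
by rewrite hE !comp_oppl !comp_oppr !opprK.
Qed.

(** The shift of a nonpositive complex lives in degrees at most -1, so a map from it to [Y] is zero
    in degree 0 and [null_extension] applies with [w = 0]. *)
Lemma neg_exact_T_ge0 Y : nonpositive Y -> neg_exact Y -> T_ge0 (Y : Kminus B).
Proof.
move=> Y0 Yex Z f [Z' [Z'0 [a [b [ba _]]]]].
have [f' ->] := khomW f; have [a' aE] := khomW a; have [b' bE] := khomW b.
move: ba; rewrite aE bE /= kcompE => /kclassP/null_shift ba.
have nb : null_homotopic (chain_comp f' (chain_shift b')).
  have Z'1 : is_zero (shift Z' 0) by exact: Z'0.
  apply: (@null_extension _ _ _ 0) => //.
    by move=> n n0; apply: Z'0; rewrite (lt_trans n0) // ltrDl.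
  by case: Z'1 => _ z; rewrite (z _ (chain_comp _ _ 0)) compm0.
apply/kclass_eq0.
have /asboolP n1 := null_compr (chain_shift a') nb; have /asboolP n2 := null_compl f' ba.
(* Up to shifts, [f = f b a - f (b a - 1)], and both terms are null-homotopic. *)
have -> : f' = chain_comp (chain_comp f' (chain_shift b')) (chain_shift a')
    - chain_comp f' (chain_shift (chain_comp b' a' - chain_id Z)).
  apply: chain_map_eq => n /=.
  by rewrite comp_addr comp_oppr compm1 -!ccompA subKr.
by apply/asboolP; apply: (@rpredB _ (null_pred (X := shift Z) (Y := Y))).
Qed.

(** A cycle [z] is a chain map out of the shift of [M] placed in degree [n + 1 + 1], which is at
    most 0; a homotopy to zero exhibits [z] as a boundary. *)
Lemma T_ge0_neg_exact Y : is_additive B -> T_ge0 (Y : Kminus B) -> neg_exact Y.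
Proof.
move=> addB Yge k M z dz; have [O O0] := has_zero addB.
set n : int := Negz k.+1 in z dz *.
(* The only possibly nonzero term is reached through a section [i] and a retraction [o], which
   replace a cast from [M]. *)
have [S [Sz [i [o oi]]]] : exists S : int -> B, (forall j : int, j <> n + 1 + 1 -> is_zero (S j)) /\
    exists (i : hom M (S (n + 1 + 1))) (o : hom (S (n + 1 + 1)) M), o \co i = idm M.
  exists (fun j => if j == n + 1 + 1 then M else O); split=> [j|].
    by case: eqP.
  by rewrite eqxx; exists (idm M), (idm M); rewrite comp1m.
have dS (j : int) : (0 : hom (S (j + 1)) (S (j + 1 + 1))) \co (0 : hom (S j) (S (j + 1))) = 0.
  exact: comp0m.
have Spos (j : int) : 0 < j -> is_zero (S j).
  by move=> j0; apply: Sz => jn; move: j0; rewrite jn /n; case: (k).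
pose SC := @Complex B S (fun j : int => 0) dS (ex_intro _ 0 Spos).
have [phi [phin phiz]] := @point_family (fun j => hom (S (j + 1)) (Y j)) (fun=> 0) (n + 1) (z \co o).
have dphi (j : int) : cxd Y j \co phi j = phi (j + 1) \co cxd (shift SC) j.
  rewrite /= oppr0 compm0; have [->|jn] := pselect (j = n + 1).
    by rewrite phin ccompA dz comp0m.
  by rewrite phiz // compm0.
have /kclass_eq0[h hE] := Yge SC (kclass (ChainMap (X := shift SC) dphi)) (@nonpositive_T_le0 SC Spos).
exists (h n \co i); rewrite ccompA; have := hE n.
rewrite /= oppr0 compm0 addr0 phin => <-.
by rewrite -ccompA oi compm1.
Qed.

End NegativelyExact.

(** * The heart *)

Section HeartPresentations.
Variables (B : preadditive) (addB : is_additive B).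
Implicit Types X Y Z : complex B.

Lemma stalk_nonpositive (M : B) : nonpositive (stalk addB M).
Proof. by case=> [[|n]|n] // _; exact: zero_objP. Qed.

Definition stalk_map Y (M : B) (u : hom M (Y 0)) (n : int) : hom (stalk addB M n) (Y n) :=
  match n with Posz 0 => u | _ => 0 end.

(** Only degree 0 needs an argument: there the differential of [Y] has zero target. *)
Lemma stalk_map_comm Y (M : B) (u : hom M (Y 0)) : nonpositive Y ->
  forall n : int, cxd Y n \co stalk_map u n = stalk_map u (n + 1) \co cxd (stalk addB M) n.
Proof.
move=> Y0 n; rewrite [RHS]compm0; case: n => [[|n]|n] /=; rewrite ?compm0 //.
by case: (Y0 (Posz 0 + 1)) => // z _; exact: z.
Qed.

Definition stalk_to Y (Y0 : nonpositive Y) (M : B) (u : hom M (Y 0)) :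
  chain_map (stalk addB M) Y := ChainMap (stalk_map_comm u Y0).

Lemma stalk_chain_eq Y (M : B) (f g : chain_map (stalk addB M) Y) : f 0 = g 0 -> f = g.
Proof.
have z V (u v : hom (zero_obj addB) V) : u = v.
  by case: (zero_objP addB) => _ z; rewrite (z _ u) (z _ v).
by move=> fg; apply: chain_map_eq; case=> [[|n]|n] //; exact: z.
Qed.

Lemma null_stalk Y (M : B) (f : chain_map (stalk addB M) Y) :
  null_homotopic f -> exists w : hom M (Y (Negz 0)), f 0 = cxd Y (Negz 0) \co w.
Proof.
case=> h /(_ (Negz 0)) hE; exists (h (Negz 0)); apply: (etrans hE).
rewrite /= -[RHS]addr0; congr (_ + _); exact: compm0.
Qed.

Lemma stalk_neg_exact (M : B) : neg_exact (stalk addB M).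
Proof.
move=> k W z _; exists 0; rewrite compm0.
by case: k z => [|k] z; case: (zero_objP addB) => z0 _; exact: z0.
Qed.

Lemma nonpositive_in_heart Y : nonpositive Y -> neg_exact Y -> in_heart (Y : Kminus B).
Proof. by move=> Y0 Yex; split; [exact: nonpositive_T_le0|exact: neg_exact_T_ge0]. Qed.

Lemma stalk_in_heart (M : B) : in_heart (stalk_functor addB M).
Proof. exact: nonpositive_in_heart (@stalk_nonpositive M) (@stalk_neg_exact M). Qed.

(** A normal form for objects of the heart, to which [null_extension] and [map_extension] apply. *)
Lemma in_heart_resolution (X : Kminus B) : in_heart X ->
  exists Y : complex B, [/\ nonpositive Y, neg_exact Y & isomorphic X (Y : Kminus B)].
Proof.
case=> [[Y [Y0 XY]] Xge]; exists Y; split=> //.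
exact: T_ge0_neg_exact addB (iso_T_ge0 XY Xge).
Qed.

Local Notation P := (P_heart stalk_in_heart).

Lemma P_heart_full : full P.
Proof.
move=> M N u; have [f fE] := khomW (u : khom (stalk addB M) (stalk addB N)).
exists (f 0); rewrite fE /=; congr kclass; exact: stalk_chain_eq.
Qed.

Lemma P_heart_faithful : faithful P.
Proof.
move=> M N f g /kclassP/null_stalk[w] /=; rewrite comp0m => /eqP.
by rewrite subr_eq0 => /eqP.
Qed.

Lemma presents_iso (H : preadditive) (F : add_functor B H) (M1 M0 : B) (m : hom M1 M0)
    (X X' : H) (q : hom (F M0) X) (a : hom X X') :
  presents m q -> is_iso a -> presents m (a \co q).
Proof.
move=> qm [a' [a'a aa']]; split.
- by rewrite -ccompA (presents_comp0 qm) compm0.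
- move=> Y u /(presents_factor qm)[v vq]; exists (v \co a').
  by rewrite -ccompA (ccompA a') a'a comp1m.
- move=> Z u v; rewrite !ccompA => /(presents_epi qm) /(congr1 (fun w => w \co a')).
  by rewrite -!ccompA aa' !compm1.
- move=> W x; have [w wE] := presents_lift qm (a' \co x); exists w.
  by rewrite -ccompA wE ccompA aa' comp1m.
- move=> W w aqw; apply: (presents_kernel qm).
  by rewrite -[LHS]comp1m -a'a -ccompA (ccompA a) aqw compm0.
Qed.

(** [q] is the identity in degree 0. Factorizations through [q] come from [map_extension] and their
    uniqueness from [null_extension]; the conditions on elements are read off in degree 0. *)
Lemma heart_presents Y (Y0 : nonpositive Y) (Yex : neg_exact Y)
    (H := exist _ (Y : Kminus B) (nonpositive_in_heart Y0 Yex) : heart B)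
    (q := kclass (stalk_to Y0 (idm (Y 0))) : hom (P (Y 0)) H) :
  presents (cxd Y (Negz 0) : hom (Y (Negz 0)) (Y 0)) q.
Proof.
have qm : q \co fmap P (cxd Y (Negz 0) : hom _ (Y 0)) = 0.
  rewrite /q /= kcompE; apply/kclass_eq0.
  apply: (@null_extension _ (stalk addB (Y (Negz 0))) Y _ (idm (Y (Negz 0)))) => //; first exact: stalk_nonpositive.
  by rewrite compm1; exact: comp1m.
(* The extension lemmas need a target in normal form, so [Z] is replaced by an isomorphic [Z']. *)
have qfactor (Z : heart B) : exists (Z' : complex B) (a : hom (sval Z) (Z' : Kminus B)),
    [/\ nonpositive Z', neg_exact Z' & is_iso a].
  have [Z' [Z0 Zex [a aiso]]] := in_heart_resolution (svalP Z).
  by exists Z', a.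
split=> //.
- move=> Z u um; have [Z' [a [Z0 Zex [a' [a'a aa']]]]] := qfactor Z.
  have [f fE] := khomW (kcomp (a : khom (sval Z) Z') (u : khom (stalk addB (Y 0)) (sval Z))).
  have [w] : exists w : hom (Y (Negz 0)) (Z' (Negz 0)),
      f 0 \co (cxd Y (Negz 0) : hom _ (Y 0)) = cxd Z' (Negz 0) \co w.
    apply: (@null_stalk Z' _ (chain_comp f (stalk_chain addB (cxd Y (Negz 0) : hom _ (Y 0))))).
    apply/kclass_eq0; rewrite -kcompE -fE -kcompA.
    by have := congr1 (kcomp (a : khom (sval Z) Z')) um; rewrite /= => ->; exact: (@compm0 (Kminus B)).
  move=> /(@map_extension _ Y Z' (f 0) w Y0 Z0 Zex)[g gE].
  exists (kcomp (a' : khom Z' (sval Z)) (kclass g)); rewrite /= -kcompA kcompE.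
  have -> : chain_comp g (stalk_to Y0 (idm (Y 0))) = f.
    by apply: stalk_chain_eq; rewrite /= compm1.
  rewrite -fE kcompA; rewrite /= in a'a; rewrite a'a; exact: kcomp1m.
- move=> Z u v uv; have [Z' [a [Z0 Zex [a' [a'a aa']]]]] := qfactor Z.
  have [f fE] := khomW (kcomp (a : khom (sval Z) Z') (u : khom Y (sval Z))).
  have [g gE] := khomW (kcomp (a : khom (sval Z) Z') (v : khom Y (sval Z))).
  have fg : kclass f = kclass g.
    apply/kclassP.
    have [|w wE] := @null_stalk Z' _ (chain_comp (f - g) (stalk_to Y0 (idm (Y 0)))).
      have -> : chain_comp (f - g) (stalk_to Y0 (idm (Y 0))) =
          chain_comp f (stalk_to Y0 (idm (Y 0))) - chain_comp g (stalk_to Y0 (idm (Y 0))).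
        by apply: chain_map_eq => n /=; rewrite comp_addl comp_oppl.
      apply/kclassP; rewrite -!kcompE -fE -gE -!kcompA; congr (kcomp _ _); exact: uv.
    apply: (@null_extension _ Y Z' _ w) => //.
    by apply: etrans wE; rewrite /= compm1.
  rewrite -fE -gE in fg; have := congr1 (kcomp (a' : khom Z' (sval Z))) fg.
  by rewrite !kcompA; rewrite /= in a'a; rewrite a'a !kcomp1m.
- move=> W x; have [f fE] := khomW (x : khom (stalk addB W) Y).
  exists (f 0); rewrite fE /= kcompE; congr kclass; apply: stalk_chain_eq.
  exact: comp1m.
- move=> W w; rewrite /= kcompE => /kclass_eq0/null_stalk[c cE].
  exists c; apply: etrans cE; rewrite /=; exact/esym/comp1m.
Qed.

Lemma heart_presented (X : heart B) : exists (M1 M0 : B) (m : hom M1 M0) (q : hom (P M0) X),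
  presents m q.
Proof.
have [Y [Y0 Yex /isomorphic_sym[a aiso]]] := in_heart_resolution (svalP X).
have qm := heart_presents Y0 Yex.
by do 3 eexists; eexists; apply: (presents_iso (a := (a : hom (exist _ _ _ : heart B) X)) qm).
Qed.

Hypothesis wkB : has_weak_kernels B.

Lemma heart_presenting (M1 M0 : B) (m : hom M1 M0) :
  exists (X : heart B) (q : hom (P M0) X), presents m q.
Proof.
have [O O0] := has_zero addB.
(* [X] is the complex obtained from [m] by taking weak kernels successively. *)
pose T := {M : B & {N : B & hom M N}}.
pose mk (M N : B) (f : hom M N) : T := existT _ M (existT _ N f).
pose src (t : T) : B := tag t.
pose tgt (t : T) : B := tag (tagged t).
pose mor (t : T) : hom (src t) (tgt t) := tagged (tagged t).
have wk (t : T) : exists s : T, exists k : hom (src s) (src t),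
    [/\ mor t \co k = 0, forall W (w : hom W (src s)), k \co w = 0 <-> mor s \co w = 0 &
      forall W (z : hom W (src t)), mor t \co z = 0 -> exists w, z = k \co w].
  have [K [k [k0 kU]]] := wkB (mor t); exists (mk _ _ k), k; split=> // W z /kU[w <-].
  by exists w.
have {wk}[next nextP] := dependent_choice wk.
(* [mor (s n)] stands in for the differential in degree [n]. Its target is not recorded as the next
   term, so the true differential [d n] is chosen afterwards and made to annihilate exactly the same
   morphisms. *)
pose s (n : int) : T := match n with
  | Posz 0 => mk M0 O 0 | Posz _ => mk O O 0 | Negz k => iter k next (mk M1 M0 m) end.
(* Keeps the differential from degree -1 to degree 0 equal to [m] itself. *)
pose pin (n : int) : hom (src (s n)) (src (s (n + 1))) -> Prop :=
  match n with Negz 0 => fun d => d = m | _ => fun=> True end.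
have /dependent_choice[d dP] (n : int) : exists d : hom (src (s n)) (src (s (n + 1))),
    [/\ pin n d, mor (s (n + 1)) \co d = 0,
      forall W (w : hom W (src (s n))), d \co w = 0 <-> mor (s n) \co w = 0 &
      n < Negz 0 -> forall W (z : hom W (src (s (n + 1)))), mor (s (n + 1)) \co z = 0 ->
        exists w, z = d \co w].
  case: n => [[|k]|[|k]].
  - by exists 0; split=> //; rewrite ?compm0 // => W w; rewrite !comp0m.
  - by exists 0; split=> //; rewrite ?compm0 // => W w; rewrite !comp0m.
  - by exists m; split=> //; exact: comp0m.
  have e : Negz k.+1 + 1 = Negz k by rewrite !NegzE -[k.+2]addn1 PoszD opprD subrK.
  suff [j jP] : exists j : hom (src (s (Negz k.+1))) (src (s (Negz k.+1 + 1))),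
      [/\ mor (s (Negz k.+1 + 1)) \co j = 0,
        forall W (w : hom W (src (s (Negz k.+1)))), j \co w = 0 <-> mor (s (Negz k.+1)) \co w = 0 &
        forall W (z : hom W (src (s (Negz k.+1 + 1)))), mor (s (Negz k.+1 + 1)) \co z = 0 ->
          exists w, z = j \co w].
    by exists j; case: jP.
  by rewrite e; exact: nextP (s (Negz k)).
have dd (n : int) : d (n + 1) \co d n = 0.
  by have [_ sd _ _] := dP n; have [_ _ dsd _] := dP (n + 1); apply/dsd.
have s0 (n : int) : 0 < n -> is_zero (src (s n)) by case: n => [[|n]|n].
pose Y : complex B := Complex dd (ex_intro _ 0 s0).
have Yex : neg_exact Y.
  move=> k W z dz; have [_ _ _ U] := dP (Negz k.+1); apply: U => //.
  by have [_ _ dsd _] := dP (Negz k.+1 + 1); apply/dsd.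
have Y0 : nonpositive Y := s0.
have [dm _ _ _] := dP (Negz 0).
have := heart_presents Y0 Yex; rewrite /= -[d _]/(d (Negz 0)) dm => qm.
by eexists; eexists; exact: qm.
Qed.

End HeartPresentations.

(** * Assembling the equivalences *)

Section Conclusion.
Variables (B : preadditive) (addB : is_additive B).
Hypotheses (wkB : has_weak_kernels B) (splitB : idempotents_split B).

Let PH := stalk_in_heart addB.
Let Ppresented := @heart_presented B addB.
Let Ppresenting := heart_presenting addB wkB.

Lemma P_heart_projective (M : B) : is_projective (P_heart PH M).
Proof. exact: P_projective addB Ppresented Ppresenting _. Qed.

Let PP := P_heart_projective.

Lemma P_proj_full : full (P_proj PP).
Proof. by move=> M N f; exact: P_heart_full f. Qed.

Lemma P_proj_faithful : faithful (P_proj PP).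
Proof. by move=> M N f g; exact: P_heart_faithful. Qed.

Lemma P_proj_ess_surjective : ess_surjective (P_proj PP).
Proof.
case=> X projX.
have [M [f [g fg]]] := projective_isomorphic splitB (@P_heart_full B addB)
  (@P_heart_faithful B addB) Ppresented projX.
by exists M, f, g.
Qed.

Lemma stalk_heart_equivalences :
  is_equivalence (P_proj PP) /\
  enough_projectives (heart B) /\
  is_equivalence (Kminus_map (P_proj PP)) /\
  is_equivalence
    (functor_comp (Dminus_functor (heart B))
       (functor_comp (Kminus_map (Proj_incl (heart B))) (Kminus_map (P_proj PP)))).
Proof.
split; first exact: equivalence_of_full_faithful P_proj_full P_proj_faithful P_proj_ess_surjective.
split; first exact: presented_enough_projectives addB Ppresented Ppresenting.
split.
  apply: equivalence_of_full_faithful.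
  - exact: Kminus_map_full P_proj_full P_proj_faithful.
  - exact: Kminus_map_faithful P_proj_full P_proj_faithful.
  - exact: Kminus_map_ess_surjective P_proj_full P_proj_faithful P_proj_ess_surjective.
(* The terms of [FQ] are literally objects [P M], so Hom(FQ, -) inverts quasi-isomorphisms. *)
have bij (Q : Kminus B) (X Y : Kminus (heart B)) (s : hom X Y) : quasi_iso s ->
    let FQ := Kminus_map (Proj_incl (heart B)) (Kminus_map (P_proj PP) Q) in
    (forall g : hom FQ Y, exists a : hom FQ X, s \co a = g) /\
    (forall a b : hom FQ X, s \co a = s \co b -> a = b).
  case=> f fs /(chain_qis_hom_qis addB wkB Ppresented Ppresenting) fqis.
  apply: (hom_qis_bijective fqis) fs => n.
  by exists ((Q : complex B) n).
have incl_full : full (Proj_incl (heart B)) by move=> X Y g; exists g.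
have incl_faithful : faithful (Proj_incl (heart B)) by [].
apply: localization_equivalence.
- move=> Q Q' g.
  have [u <-] := Kminus_map_full incl_full incl_faithful g.
  have [v <-] := Kminus_map_full P_proj_full P_proj_faithful u.
  by exists v.
- move=> Q Q' u v uv; apply: (Kminus_map_faithful P_proj_full P_proj_faithful).
  exact: (Kminus_map_faithful incl_full incl_faithful).
- by move=> Q X Y s sW; case: (bij Q X Y s sW).
- by move=> Q X Y s sW; case: (bij Q X Y s sW).
move=> X.
have [Y [p pqis]] := projective_resolution addB wkB (@P_heart_full B addB)
  (@P_heart_faithful B addB) Ppresented X.
have e : map_complex (Proj_incl (heart B)) (map_complex (P_proj PP) Y) = map_complex (P_heart PH) Y.
  exact: Complex_irrelevance.
exists Y; rewrite /= e; exists (kclass p), p => //.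
exact: hom_qis_chain_qis addB Ppresented Ppresenting _ _ _ pqis.
Qed.

End Conclusion.

Theorem proposition3p17 (A : preadditive) (abA : is_abelian A)
  (C : A -> Prop) (addC : is_additive (fullsub C))
  (strictC : strictly_full C) (karC : karoubi_closed C)
  (approxC : approximating C) :
  exists (PH : forall M : fullsub C, in_heart (stalk_functor addC M))
         (PP : forall M : fullsub C, is_projective (P_heart PH M)),
    is_equivalence (P_proj PP) /\
    enough_projectives (heart (fullsub C)) /\
    is_equivalence (Kminus_map (P_proj PP)) /\
    is_equivalence
      (functor_comp (Dminus_functor (heart (fullsub C)))
         (functor_comp (Kminus_map (Proj_incl (heart (fullsub C))))
            (Kminus_map (P_proj PP)))).
Proof.
(* The approximation property enters through weak kernels, Karoubi closure through the splitting of
   idempotents. *)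
have wk := approximating_weak_kernels abA addC approxC.
have sp := karoubi_idempotents_split abA karC.
exists (stalk_in_heart addC), (P_heart_projective wk).
exact: stalk_heart_equivalences.
Qed.
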